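(* Let $R$ be a commutative ring, let $S$ be an $R$-algebra (not necessarily commutative), and let $K$, $L$, $M$, $N$, $P$ be right $S$-modules. Assume the following: (1) $R$ is a Noetherian ring. (2) $N$ is a finitely generated $S$-module, and $S$ is a module-finite $R$-algebra. (3) $P$ is a finitely generated direct summand of $M$ over $S$, and $N_{\mathfrak p}^{\oplus(1+\dim_X(\mathfrak p))}$ is a direct summand of $P_{\mathfrak p}$ over $S_{\mathfrak p}$ for every $\mathfrak p\in X:=j\text{-}\mathrm{Spec}(R)\cap\mathrm{Supp}_R(N)$. Then $N\oplus L\cong N\oplus M$ implies $L\cong M$. More generally, if $K$ is a direct summand of a direct sum of finitely many copies of $N$ over $S$, then $K\oplus L\cong K\oplus M$ implies $L\cong M$.
   Context: Rings are associative with unity and modules are unital. An algebra $S$ over a commutative ring $R$ is a ring with a unital ring homomorphism $R\to S$ whose image lies in the center of $S$; it is module-finite if it is finitely generated as an $R$-module. Localizations at a prime $\mathfrak p$ of $R$ are at the multiplicative set $R\setminus\mathfrak p$. $j\text{-}\mathrm{Spec}(R)$ is the set of prime ideals of $R$ that are intersections of maximal ideals of $R$, with the subspace topology from the Zariski topology on $\mathrm{Spec}(R)$; $\mathrm{Supp}_R(N)=\{\mathfrak p\in\mathrm{Spec}(R):N_{\mathfrak p}\neq0\}$; $X$ has the subspace topology. The Krull dimension of a space is the supremum of the lengths of chains of distinct closed irreducible subsets; for $\mathfrak p\in X$, $\dim_X(\mathfrak p)$ is the Krull dimension of the closure of $\{\mathfrak p\}$ in $X$. If $\dim_X(\mathfrak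 p)=\infty$, condition (3) at $\mathfrak p$ is read as: $N_{\mathfrak p}^{\oplus n}$ is a direct summand of $P_{\mathfrak p}$ for every nonnegative integer $n$. *)

(* Defs.v *)
From HB Require Import structures.
From mathcomp Require Import all_boot all_order all_algebra all_classical topology.
From mathcomp Require Import ring.

Set Implicit Arguments.
Unset Strict Implicit.
Unset Printing Implicit Defensive.

Import GRing.Theory.

Local Open Scope classical_set_scope.
Local Open Scope ring_scope.
Local Open Scope quotient_scope.

(* Rings and algebras are allowed to be zero, hence the [pz] structures of
   MathComp; its [algType] and the ideals of [ring_quotient] assume 1 != 0.
   A right S-module is a left module over the converse ring S^c. *)

Section Modules.
Variable T : pzRingType.

Definition isomorphic (A B : lmodType T) : Prop :=
  exists f : {linear A -> B}, bijective f.

Definition direct_summand (A B : lmodType T) : Prop :=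
  exists C : lmodType T, isomorphic (A * C)%type B.

Definition copies (n : nat) (A : lmodType T) : lmodType T := {ffun 'I_n -> A}.

Definition finitely_generated (A : lmodType T) : Prop :=
  exists n (g : 'I_n -> A), forall x, exists c : 'I_n -> T,
    x = \sum_(i < n) c i *: g i.

End Modules.

Section Ideals.
Variable R : comPzRingType.

Definition ideal (I : set R) : Prop :=
  [/\ I 0, forall x y, I x -> I y -> I (x + y) & forall r x, I x -> I (r * x)].

Definition prime_ideal (p : set R) : Prop :=
  [/\ ideal p, ~ p 1 & forall x y, p (x * y) -> p x \/ p y].

Definition maximal_ideal (m : set R) : Prop :=
  [/\ ideal m, ~ m 1 & forall J, ideal J -> m `<=` J -> J = m \/ J = setT].

Definition noetherian : Prop :=
  forall I, ideal I -> exists n (g : 'I_n -> R),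
    I = [set x | exists c : 'I_n -> R, x = \sum_(i < n) c i * g i].

Record spec := Spec { spec_set :> set R; specP : prime_ideal spec_set }.

HB.instance Definition _ := gen_eqMixin spec.
HB.instance Definition _ := gen_choiceMixin spec.

Definition zero_locus (E : set R) : set spec := [set p : spec | E `<=` p].

Definition zariski_open (U : set spec) : Prop := exists E, U = ~` zero_locus E.

Lemma zariski_openT : zariski_open setT.
Proof.
exists setT; apply/seteqP; split => // p _ /(_ 1 I).
by case: (specP p).
Qed.

Lemma zariski_openI : setI_closed zariski_open.
Proof.
move=> _ _ [E ->] [F ->]; exists [set z | exists x y, [/\ E x, F y & z = x * y]].
rewrite -setCU; congr (~` _); apply/seteqP; split => p.
  have [[_ _ pM] _ _] := specP p.
  case=> Hp _ [x [y [Ex Fy ->]]]; last exact/pM/Hp.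
  by rewrite mulrC; exact/pM/Hp.
have [_ _ pP] := specP p.
move=> Hp; rewrite /setU /=.
have [|/existsNP[x /not_implyP[Ex npx]]] := pselect (E `<=` p); first by left.
right => y Fy; have [||//] := pP x y; last by move/npx.
by apply: Hp; exists x, y.
Qed.

Lemma zariski_open_bigU (J : Type) (f : J -> set spec) :
  (forall i, zariski_open (f i)) -> zariski_open (\bigcup_i f i).
Proof.
move=> /choice[E fE]; exists (\bigcup_i E i).
under eq_bigcupr do rewrite fE.
rewrite -setC_bigcap; congr (~` _); apply/seteqP; split => p Hp.
  by move=> x [i _ /(Hp i)]; apply.
by move=> i _ x Ex; apply: Hp; exists i.
Qed.

HB.instance Definition _ := isOpenTopological.Build spec
  zariski_openT zariski_openI zariski_open_bigU.

Definition jspec : set spec :=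
  [set p : spec | exists2 F : set (set R),
     (forall m, F m -> maximal_ideal m) & p = \bigcap_(m in F) m :> set R].

End Ideals.

Arguments jspec : clear implicits.

(* Least upper bound in nat extended by infinity, encoded as [None]; the empty
   set gets 0, so that below the empty space has dimension 0. *)
Definition nat_sup (A : set nat) : option nat :=
  match pselect (exists n, `[< ubound A n >]) with
  | left bA => Some (ex_minn bA)
  | right _ => None
  end.

Section Krull.
Variable T : topologicalType.

Definition irreducible (Z : set T) : Prop :=
  Z !=set0 /\ forall A B, closed A -> closed B ->
    Z `<=` A `|` B -> Z `<=` A \/ Z `<=` B.

Definition closed_irreducible_chain (n : nat) (Z : 'I_n.+1 -> set T) : Prop :=
  (forall i, closed (Z i) /\ irreducible (Z i)) /\
  (forall i j : 'I_n.+1, (i < j)%N -> Z i `<` Z j).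

Definition krull_dim : option nat :=
  nat_sup [set n | exists Z : 'I_n.+1 -> set T, closed_irreducible_chain Z].

End Krull.

(* A set A : set T coerces to the type [set_type A], which carries the subspace
   topology; both X and the closure of {p} in X are used in this way. *)
Definition dim_at (T : topologicalType) (X : set T) (p : X) : option nat :=
  krull_dim (closure [set p] : set X).

Section Denominators.
Variables (R : comPzRingType) (p : spec R).

Record denom := Denom { dval : R; denomP : ~ (p : set R) dval }.

HB.instance Definition _ := gen_eqMixin denom.
HB.instance Definition _ := gen_choiceMixin denom.

Lemma denom1_subproof : ~ (p : set R) 1.
Proof. by case: (specP p). Qed.

Definition denom1 : denom := Denom denom1_subproof.

Lemma denomM_subproof (u v : denom) : ~ (p : set R) (dval u * dval v).
Proof.
by have [_ _ pP] := specP p; case: u v => [u nu] [v nv] /= /pP[].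
Qed.

Definition denomM (u v : denom) : denom := Denom (@denomM_subproof u v).

End Denominators.

Section LocalizedGroup.
Variables (R : comPzRingType) (p : spec R) (A : lmodType R).
Implicit Types (a b c : A) (u v w : denom p).

Definition loc_equiv (x y : A * denom p) : bool :=
  `[< exists w : denom p,
      dval w *: (dval y.2 *: x.1) = dval w *: (dval x.2 *: y.1) >].

Lemma loc_equiv_is_equiv : equiv_class_of loc_equiv.
Proof.
split=> [x | x y | y x z].
- by apply/asboolP; exists (denom1 p).
- by apply: asbool_equiv_eq; split=> -[w e]; exists w.
- move=> /asboolP[w e] /asboolP[w' e']; apply/asboolP.
  exists (denomM (denomM w w') y.2); rewrite /= !scalerA in e e' *.
  have -> : dval w * dval w' * dval y.2 * dval z.2
    = (dval w' * dval z.2) * (dval w * dval y.2) by ring.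
  rewrite -scalerA e scalerA.
  have -> : dval w' * dval z.2 * (dval w * dval x.2)
    = (dval w * dval x.2) * (dval w' * dval z.2) by ring.
  by rewrite -scalerA e' scalerA; congr (_ *: _); ring.
Qed.

Canonical loc_equiv_equiv := EquivRelPack loc_equiv_is_equiv.

Definition loc : Type := {eq_quot loc_equiv}.
HB.instance Definition _ := Choice.on loc.

Definition frac a u : loc := \pi_{eq_quot loc_equiv} (a, u).

Lemma frac_eqP a u b v : frac a u = frac b v <->
  exists w, dval w *: (dval v *: a) = dval w *: (dval u *: b).
Proof.
split=> [/eqmodP/asboolP // | H]; exact/eqmodP/asboolP.
Qed.

Lemma frac_eq_sim a u b v : dval v *: a = dval u *: b -> frac a u = frac b v.
Proof. by move=> e; apply/frac_eqP; exists (denom1 p); rewrite e. Qed.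

Lemma fracP (x : loc) : exists a u, x = frac a u.
Proof.
exists (repr (x : {eq_quot loc_equiv})).1, (repr (x : {eq_quot loc_equiv})).2.
by rewrite /frac -surjective_pairing reprK.
Qed.

Definition num (x : loc) : A := (repr (x : {eq_quot loc_equiv})).1.
Definition den (x : loc) : denom p := (repr (x : {eq_quot loc_equiv})).2.

Lemma frac_num_den x : frac (num x) (den x) = x.
Proof. by rewrite /frac -surjective_pairing reprK. Qed.

Definition loc_zero : loc := frac 0 (denom1 p).
Definition loc_opp x : loc := frac (- num x) (den x).
Definition loc_add x y : loc :=
  frac (dval (den y) *: num x + dval (den x) *: num y) (denomM (den x) (den y)).

Lemma loc_oppE a u : loc_opp (frac a u) = frac (- a) u.
Proof.
have /frac_eqP[w e] := frac_num_den (frac a u).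
by apply/frac_eqP; exists w; rewrite !scalerN e.
Qed.

Lemma loc_addE a u b v :
  loc_add (frac a u) (frac b v) = frac (dval v *: a + dval u *: b) (denomM u v).
Proof.
have /frac_eqP[w e] := frac_num_den (frac a u).
have /frac_eqP[w' e'] := frac_num_den (frac b v).
rewrite /loc_add; move: (frac a u) (frac b v) e e' => x y e e'.
apply/frac_eqP; exists (denomM w w'); rewrite /= !scalerDr !scalerA in e e' *.
congr (_ + _).
- have -> : dval w * dval w' * (dval u * dval v) * dval (den y) =
    (dval w' * (dval v * dval (den y))) * (dval w * dval u) by ring.
  by rewrite -scalerA e scalerA; congr (_ *: _); ring.
- have -> : dval w * dval w' * (dval u * dval v) * dval (den x) =
    (dval w * (dval u * dval (den x))) * (dval w' * dval v) by ring.
  by rewrite -scalerA e' scalerA; congr (_ *: _); ring.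
Qed.

Lemma loc_addA : associative loc_add.
Proof.
move=> x y z.
have [a [u ->]] := fracP x; have [b [v ->]] := fracP y.
have [c [w ->]] := fracP z.
rewrite !loc_addE; apply: frac_eq_sim.
rewrite /= !scalerDr !scalerA addrA.
by congr (_ *: _ + _ *: _ + _ *: _); ring.
Qed.

Lemma loc_addC : commutative loc_add.
Proof.
move=> x y; have [a [u ->]] := fracP x; have [b [v ->]] := fracP y.
by rewrite !loc_addE; apply: frac_eq_sim; rewrite /= mulrC addrC.
Qed.

Lemma loc_add0 : left_id loc_zero loc_add.
Proof.
move=> x; have [a [u ->]] := fracP x; rewrite /loc_zero loc_addE.
by apply: frac_eq_sim; rewrite /= scaler0 add0r scale1r mul1r.
Qed.

Lemma loc_addN : left_inverse loc_zero loc_opp loc_add.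
Proof.
move=> x; have [a [u ->]] := fracP x; rewrite loc_oppE loc_addE.
by apply: frac_eq_sim; rewrite /= scalerN addNr !scaler0.
Qed.

HB.instance Definition _ :=
  GRing.isZmodule.Build loc loc_addA loc_addC loc_add0 loc_addN.

Lemma fracD a u b v :
  frac a u + frac b v = frac (dval v *: a + dval u *: b) (denomM u v).
Proof. exact: loc_addE. Qed.

Lemma frac0 u : frac 0 u = 0.
Proof. by apply: frac_eq_sim; rewrite !scaler0. Qed.

End LocalizedGroup.

Record algebra_on (R : comPzRingType) (S : pzRingType) := AlgebraOn {
  alg_map :> {rmorphism R -> S};
  alg_map_central : forall r s, alg_map r * s = s * alg_map r }.

Definition restrict (R : comPzRingType) (S : pzRingType) (phi : algebra_on R S)
  (N : lmodType S^c) : Type := N.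

Section Restriction.
Variables (R : comPzRingType) (S : pzRingType) (phi : algebra_on R S).

Variable N : lmodType S^c.
Let scale (r : R) (x : restrict phi N) : restrict phi N := (phi r : S^c) *: (x : N).

HB.instance Definition _ := GRing.Zmodule.copy (restrict phi N) N.

Let scaleA a b v : scale a (scale b v) = scale (a * b) v.
Proof. by rewrite /scale scalerA rmorphM alg_map_central. Qed.
Let scale1 : left_id 1 scale.
Proof. by move=> v; rewrite /scale rmorph1 scale1r. Qed.
Let scaleDr : right_distributive scale +%R.
Proof. by move=> r x y; rewrite /scale scalerDr. Qed.
Let scaleDl v : {morph scale^~ v : a b / a + b}.
Proof. by move=> a b; rewrite /scale rmorphD scalerDl. Qed.

HB.instance Definition _ := GRing.Zmodule_isLmodule.Build R (restrict phi N)
  scaleA scale1 scaleDr scaleDl.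
End Restriction.

Section LocalizedAlgebra.
Variables (R : comPzRingType) (S : pzRingType) (phi : algebra_on R S).
Variable p : spec R.

(* The localized algebra is the localization of S as an R-module. *)
Definition loc_alg : Type := loc p (restrict phi (S^c)^o).
HB.instance Definition _ := GRing.Zmodule.on loc_alg.

Definition afrac (a : S) (u : denom p) : loc_alg :=
  frac (a : restrict phi (S^c)^o) u.

Definition loc_one : loc_alg := afrac 1 (denom1 p).
Definition loc_mul (x y : loc_alg) : loc_alg :=
  afrac ((num x : S) * (num y : S)) (denomM (den x) (den y)).

Lemma afrac_eqP a u b v : afrac a u = afrac b v <->
  exists w : denom p, phi (dval w) * (phi (dval v) * a) =
    phi (dval w) * (phi (dval u) * b).
Proof.
split=> [/frac_eqP[w e] | [w e]]; [exists w | apply/frac_eqP; exists w].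
  by move: e; rewrite !alg_map_central.
by move: e; rewrite !alg_map_central.
Qed.

Lemma afrac_eq_sim a u b v :
  phi (dval v) * a = phi (dval u) * b -> afrac a u = afrac b v.
Proof. by move=> e; apply/afrac_eqP; exists (denom1 p); rewrite e. Qed.

Lemma afracP (x : loc_alg) : exists a u, x = afrac a u.
Proof. exact: (@fracP R p (restrict phi (S^c)^o)). Qed.

Lemma afracD a u b v : afrac a u + afrac b v =
  afrac (phi (dval v) * a + phi (dval u) * b) (denomM u v).
Proof. by rewrite [LHS]fracD !alg_map_central. Qed.

Lemma afrac_num_den (x : loc_alg) : afrac (num x) (den x) = x.
Proof. exact: (@frac_num_den R p (restrict phi (S^c)^o)). Qed.

Let algCA r (x y : S) : x * (phi r * y) = phi r * (x * y).
Proof. by rewrite !mulrA alg_map_central. Qed.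

Let alg_mulACA r s t q (x y : S) : phi (r * s) * (phi (t * q) * (x * y)) =
  (phi r * (phi t * x)) * (phi s * (phi q * y)).
Proof.
rewrite !rmorphM -!mulrA !(algCA _ x); congr (_ * _).
by rewrite algCA.
Qed.

Lemma loc_mulE a u b v :
  loc_mul (afrac a u) (afrac b v) = afrac (a * b) (denomM u v).
Proof.
have /afrac_eqP[w e] := afrac_num_den (afrac a u).
have /afrac_eqP[w' e'] := afrac_num_den (afrac b v).
apply/afrac_eqP; exists (denomM w w').
by rewrite /= !alg_mulACA e e'.
Qed.

Lemma loc_mulA : associative loc_mul.
Proof.
move=> x y z.
have [a [u ->]] := afracP x; have [b [v ->]] := afracP y.
have [c [w ->]] := afracP z.
rewrite !loc_mulE; apply: afrac_eq_sim.
by rewrite /= !mulrA.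
Qed.

Lemma loc_mul1l : left_id loc_one loc_mul.
Proof.
move=> x; have [a [u ->]] := afracP x; rewrite loc_mulE.
by apply: afrac_eq_sim; rewrite /= !mul1r.
Qed.

Lemma loc_mul1r : right_id loc_one loc_mul.
Proof.
move=> x; have [a [u ->]] := afracP x; rewrite loc_mulE.
by apply: afrac_eq_sim; rewrite /= !mulr1.
Qed.

Lemma loc_mulDl : left_distributive loc_mul +%R.
Proof.
move=> x y z.
have [a [u ->]] := afracP x; have [b [v ->]] := afracP y.
have [c [w ->]] := afracP z.
rewrite afracD !loc_mulE afracD; apply: afrac_eq_sim.
rewrite /= !mulrDl !mulrDr !mulrA -!(rmorphM phi).
by congr (_ * _ * _ + _ * _ * _); congr (phi _); ring.
Qed.

Lemma loc_mulDr : right_distributive loc_mul +%R.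
Proof.
move=> x y z.
have [a [u ->]] := afracP x; have [b [v ->]] := afracP y.
have [c [w ->]] := afracP z.
rewrite afracD !loc_mulE afracD; apply: afrac_eq_sim.
rewrite /= !mulrDr !(algCA _ a) !mulrA -!(rmorphM phi).
by congr (_ * _ * _ + _ * _ * _); congr (phi _); ring.
Qed.

HB.instance Definition _ := GRing.Zmodule_isPzRing.Build loc_alg
  loc_mulA loc_mul1l loc_mul1r loc_mulDl loc_mulDr.

Lemma afracM a u b v : afrac a u * afrac b v = afrac (a * b) (denomM u v).
Proof. exact: loc_mulE. Qed.

End LocalizedAlgebra.

Section LocalizedModule.
Variables (R : comPzRingType) (S : pzRingType) (phi : algebra_on R S).
Variables (p : spec R) (N : lmodType S^c).

Definition loc_mod : Type := loc p (restrict phi N).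
HB.instance Definition _ := GRing.Zmodule.on loc_mod.

Let sact (s : S) (x : restrict phi N) : restrict phi N := (s : S^c) *: (x : N).

Let sactZ s r x : sact s (r *: x) = r *: sact s x.
Proof.
rewrite /sact [LHS]scalerA [RHS]scalerA.
exact: (congr1 (fun z : S^c => z *: (x : N)) (alg_map_central phi r s)).
Qed.

Let sact_alg r s x : sact (phi r * s) x = r *: sact s x.
Proof. by rewrite alg_map_central /sact [RHS]scalerA. Qed.

Let sactD s x y : sact s (x + y) = sact s x + sact s y.
Proof. exact: (@scalerDr S^c N s x y). Qed.

Let sactDl s t x : sact (s + t) x = sact s x + sact t x.
Proof. exact: (@scalerDl S^c N x s t). Qed.

Definition mfrac (x : N) (u : denom p) : loc_mod :=
  frac (x : restrict phi N) u.

Definition loc_scale (s : (loc_alg phi p)^c) (x : loc_mod) : loc_mod :=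
  mfrac ((num (s : loc_alg phi p) : S^c) *: (num x : N))
        (denomM (den (s : loc_alg phi p)) (den x)).

Lemma mfracP (x : loc_mod) : exists a u, x = mfrac a u.
Proof. exact: (@fracP R p (restrict phi N)). Qed.

Lemma loc_scaleE s u x v :
  loc_scale (afrac phi s u) (mfrac x v) = mfrac ((s : S^c) *: x) (denomM u v).
Proof.
have /afrac_eqP[w e] := afrac_num_den (afrac phi s u).
have /frac_eqP[w' e'] := frac_num_den (frac (x : restrict phi N) v).
rewrite /loc_scale /mfrac.
move: (num _) (den _) e => s' u' e.
move: (num _) (den _) e' => x' v' e'.
apply/frac_eqP; exists (denomM w w').
have H (k l m n : R) (t : S) (y : restrict phi N) :
    (k * l) *: ((m * n) *: sact t y) =
    sact (phi k * (phi m * t)) (l *: (n *: y)).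
  by rewrite !sact_alg !sactZ !scalerA; congr (_ *: _); ring.
by rewrite /= [LHS]H [RHS]H e e'.
Qed.

Lemma loc_scaleA a b x : loc_scale a (loc_scale b x) = loc_scale (a * b) x.
Proof.
have [s [u ->]] := afracP a; have [t [v ->]] := afracP b.
have [y [w ->]] := mfracP x.
have -> : (afrac phi s u : (loc_alg phi p)^c) * afrac phi t v =
  afrac phi ((s : S^c) * t) (denomM u v).
  rewrite [LHS](@afracM R S phi p); apply: afrac_eq_sim.
  by rewrite /= mulrC.
rewrite !loc_scaleE scalerA; apply: frac_eq_sim.
by congr (_ *: _); rewrite /= mulrA.
Qed.

Lemma loc_scale1 : left_id (1 : (loc_alg phi p)^c) loc_scale.
Proof.
move=> x; have [y [w ->]] := mfracP x.
rewrite [LHS]loc_scaleE scale1r; apply: frac_eq_sim.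
by rewrite /= mul1r.
Qed.

Lemma mfracD x u y v : mfrac x u + mfrac y v =
  frac (dval v *: (x : restrict phi N) + dval u *: (y : restrict phi N))
    (denomM u v).
Proof. exact: fracD. Qed.

Lemma loc_scaleDr : right_distributive loc_scale +%R.
Proof.
move=> a x y.
have [s [u ->]] := afracP a; have [x' [v ->]] := mfracP x.
have [y' [w ->]] := mfracP y.
rewrite mfracD [LHS]loc_scaleE !loc_scaleE mfracD; apply: frac_eq_sim.
rewrite -!/(sact _ _) sactD !sactZ !scalerDr !scalerA.
by congr (_ *: _ + _ *: _); rewrite /=; ring.
Qed.

Lemma loc_scaleDl x : {morph loc_scale^~ x : a b / a + b}.
Proof.
move=> a b.
have [s [u ->]] := afracP a; have [t [v ->]] := afracP b.
have [y [w ->]] := mfracP x.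
rewrite [afrac phi s u + _](@afracD R S phi p) !loc_scaleE mfracD.
apply: frac_eq_sim.
rewrite -!/(sact _ _) sactDl !sact_alg !scalerDr !scalerA.
by congr (_ *: _ + _ *: _); rewrite /=; ring.
Qed.

HB.instance Definition _ := GRing.Zmodule_isLmodule.Build (loc_alg phi p)^c
  loc_mod loc_scaleA loc_scale1 loc_scaleDr loc_scaleDl.

Lemma mfracZ s u x v : (afrac phi s u : (loc_alg phi p)^c) *: mfrac x v =
  mfrac ((s : S^c) *: x) (denomM u v).
Proof. exact: loc_scaleE. Qed.

End LocalizedModule.

Definition module_finite (R : comPzRingType) (S : pzRingType)
  (phi : algebra_on R S) : Prop :=
  finitely_generated (restrict phi (S^c)^o : lmodType R).

Definition supp (R : comPzRingType) (S : pzRingType) (phi : algebra_on R S)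
  (N : lmodType S^c) : set (spec R) :=
  [set p | exists x : loc_mod phi p N, x != 0].

(* The direct sum of 1 + d copies of A is a summand of B; an infinite d, that
   is [None], asks for every finite number of copies. *)
Definition many_copies_summand (T : pzRingType) (d : option nat)
  (A B : lmodType T) : Prop :=
  match d with
  | Some d => direct_summand (copies (1 + d)%N A) B
  | None => forall n, direct_summand (copies n A) B
  end.

(* Main.v *)
(* Cancelling copies of N one at a time, N + L = N + M presents L as the cokernel
   of a split monomorphism (a, m) from N to N + M, and L is isomorphic to M as
   soon as m + h a is split for some h : N -> M; this reduces to maps into P.

   Start from a list (m, h_1, ..., h_r) where the h_i generate Hom(N, P).  At each
   p in X, a power N^t with t = 1 + dim p splits off its span locally.  Following
   Eisenbud and Evans, drop the last h from the list, replacing (m, h_i) by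
   (m + h c_0 a, h_i + h c_i): for all c the splitting exponent falls at most by
   one, so c only matters at the finitely many generic points of the loci where
   the exponent is small.  When the list is reduced to one element, it is split
   at all maximal ideals, hence split.

   Both local facts come from a stable range property of E = End(N^r) at p: if
   alpha E + eta E = E = E alpha + E a then alpha + eta c a is a unit for some c.
   Modulo its Jacobson radical the localization of E is a semiprime ring of
   finite length, and there a c maximizing the right ideal generated by
   alpha + eta c a will do. *)
Require Import Defs.
From HB Require Import structures.
From mathcomp Require Import all_boot all_order all_algebra all_classical topology.
From mathcomp Require Import ring zify.

Set Implicit Arguments.
Unset Strict Implicit.
Unset Printing Implicit Defensive.

Import Order.TTheory GRing.Theory.

Local Open Scope classical_set_scope.
Local Open Scope ring_scope.

(** * Semiprime rings of finite length *)

(** The invariant carried down the list: at each [p] in X the exponent is at least the smaller of 1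
    + dim p and the length of the list. Dropping an entry costs at most one, so the invariant is in
    danger only at points whose exponent is exactly 1 + dim p, below the length. Such a [p] is a
    generic point of the locus where the exponent is at most 1 + dim p: a point of X strictly inside
    [p] has larger dimension, hence larger exponent. This is where 1 + dim p comes from.

    The first entry may move only by multiples of [a], so the relation f m + b a = 1 is kept as part
    of the data. It provides the left half of the hypothesis of the stable range property, and the
    local splitting provides the right half.

    Local splittings are expressed by maps over S together with one scalar denominator outside [p].
    Perturbations are therefore global from the outset and can be compared at different primes;
    localized rings and modules occur only inside the stable range argument and in reading off
    hypothesis (3). *)

Lemma exists_minimizer (T : Type) (P : T -> Prop) (f : T -> nat) :
  (exists x, P x) -> exists2 x, P x & forall y, P y -> (f x <= f y)%N.
Proof.
move=> [x0 Px0].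
have ex : exists n, `[< exists2 x, P x & f x = n >].
  by exists (f x0); apply/asboolP; exists x0.
case: (ex_minnP ex) => n /asboolP[x Px <-] min_n.
by exists x => // y Py; apply: min_n; apply/asboolP; exists y.
Qed.

Lemma exists_maximizer (T : Type) (P : T -> Prop) (f : T -> nat) (n : nat) :
  (forall x, P x -> (f x <= n)%N) -> (exists x, P x) ->
  exists2 x, P x & forall y, P y -> (f y <= f x)%N.
Proof.
move=> bf exP.
have [x Px min_x] := exists_minimizer (fun x => n - f x)%N exP.
exists x => // y Py; have := min_x y Py; have := bf _ Px; have := bf _ Py.
lia.
Qed.

Section SemiprimeFiniteLength.
Variable A : pzRingType.

Definition right_ideal (U : set A) : Prop :=
  [/\ U 0, forall x y, U x -> U y -> U (x + y) & forall x a, U x -> U (x * a)].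

Definition principal (x : A) : set A := [set y | exists a, y = x * a].

Lemma right_ideal_principal x : right_ideal (principal x).
Proof.
split; first by exists 0; rewrite mulr0.
  by move=> _ _ [a ->] [b ->]; exists (a + b); rewrite mulrDr.
by move=> _ b [a ->]; exists (a * b); rewrite mulrA.
Qed.

Lemma right_idealN U x : right_ideal U -> U x -> U (- x).
Proof. by move=> [_ _ UM] Ux; rewrite -[x]mulr1 -mulrN; apply: UM. Qed.

Lemma right_idealB U x y : right_ideal U -> U x -> U y -> U (x - y).
Proof. by move=> rU Ux Uy; case: (rU) => _ UD _; apply: UD => //; apply: right_idealN. Qed.

Hypothesis semiprime : forall x : A, (forall y, x * y * x = 0) -> x = 0.
(** A bounded measure that detects strict inclusion of right ideals replaces length: it yields both
    chain conditions. *)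
Variables (mu : set A -> nat) (n : nat).
Hypothesis mu_bounded : forall U, (mu U <= n)%N.
Hypothesis mu_strict : forall U V, right_ideal U -> right_ideal V ->
  U `<=` V -> (mu V <= mu U)%N -> V `<=` U.

(** Brauer's lemma. In a minimal nonzero right ideal [M], some [z] of [M] acts bijectively on [M] by
    left multiplication; then [z = z * g] with [g] in [M] forces [g] to be idempotent. *)
Lemma right_ideal_idempotent U : right_ideal U -> (exists2 x, U x & x <> 0) ->
  exists e, [/\ U e, e * e = e & e <> 0].
Proof.
move=> rU [x0 Ux0 x0n0].
pose good V := [/\ right_ideal V, V `<=` U & exists2 x, V x & x <> 0].
have [|M [rM MU [x Mx xn0]] minM] := @exists_minimizer _ good mu.
  by exists U; split=> //; exists x0.
have [y xyx] : exists y, x * y * x <> 0.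
  by apply/existsNP => /semiprime.
case: (rM) => M0 MD MM.
pose z := x * y; have Mz : M z by apply: MM.
pose zM := [set w | exists2 g, M g & w = z * g].
have r_zM : right_ideal zM.
  split; first by exists 0; rewrite ?mulr0.
    by move=> _ _ [g Mg ->] [h Mh ->]; exists (g + h); rewrite ?mulrDr //; apply: MD.
  by move=> _ a [g Mg ->]; exists (g * a); rewrite ?mulrA //; apply: MM.
have zM_M : zM `<=` M by move=> _ [g Mg ->]; apply: MM.
have [g Mg zg] : zM z.
  apply: (mu_strict r_zM rM zM_M) => //; apply: minM; split=> //.
  - exact: subset_trans zM_M MU.
  - by exists (z * x) => //; exists x.
pose V := [set w | M w /\ z * w = 0].
have rV : right_ideal V.
  split; first by rewrite /V /= mulr0.
    by move=> u v [Mu zu] [Mv zv]; split; [apply: MD | rewrite mulrDr zu zv addr0].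
  by move=> u a [Mu zu]; split; [apply: MM | rewrite mulrA zu mul0r].
have V0 w : V w -> w = 0.
  move=> Vw; apply: contrapT => wn0.
  have VM : V `<=` M by move=> v; case.
  have muV : (mu M <= mu V)%N.
    by apply: minM; split=> //; [exact: subset_trans VM MU | exists w].
  by have [] := mu_strict rV rM VM muV Mx.
exists g; split; first exact: MU.
  apply/eqP; rewrite -subr_eq0; apply/eqP/V0; split.
    by apply: right_idealB => //; apply: MM.
  by rewrite mulrBr mulrA -zg -zg subrr.
move=> g0; move: xyx; rewrite -/z zg g0 mulr0 mul0r; exact.
Qed.

(** An idempotent [e] of [U] with the largest [principal e] works: if it failed to fix [U], the part
    of [U] that it annihilates would contain another idempotent and enlarge it. *)
Lemma right_ideal_generator U : right_ideal U ->
  exists e, [/\ U e, e * e = e & forall x, U x -> e * x = x].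
Proof.
move=> rU; case: (rU) => U0 UD UM.
pose good e := U e /\ e * e = e.
have [||e [Ue ee] maxe] := @exists_maximizer _ good (fun e => mu (principal e)) n.
- by move=> *; apply: mu_bounded.
- by exists 0; rewrite /good mulr0.
exists e; split=> // x Ux; apply: contrapT => exx.
pose V := [set w | U w /\ e * w = 0].
have rV : right_ideal V.
  split; first by rewrite /V /= mulr0.
    by move=> u v [Mu zu] [Mv zv]; split; [apply: UD | rewrite mulrDr zu zv addr0].
  by move=> u a [Mu zu]; split; [apply: UM | rewrite mulrA zu mul0r].
have [|f [[Uf ef] ff fn0]] := right_ideal_idempotent rV.
  exists (x - e * x); last by move=> /subr0_eq /esym.
  split; first by apply: right_idealB => //; apply: UM.
  by rewrite mulrBr mulrA ee subrr.
(* [e * f] vanishes but [f * e] need not; the correction makes [e'] an idempotent that fixes both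
   [e] and [f]. *)
pose e' := e + f - f * e.
have e'e : e' * e = e.
  by rewrite /e' mulrBl mulrDl ee -mulrA ee addrK.
have e'f : e' * f = f.
  by rewrite /e' mulrBl mulrDl ef ff -mulrA ef mulr0 subr0 add0r.
have : principal e' `<=` principal e.
  apply: mu_strict; try exact: right_ideal_principal.
    by move=> _ [a ->]; exists (e * a); rewrite mulrA e'e.
  apply: maxe; split.
    by apply: right_idealB; rewrite ?/e' //; [apply: UD | apply: UM].
  by rewrite {2}/e' mulrBr mulrDr mulrA e'e e'f.
move=> /(_ f)[]; first by exists f.
by move=> a fa; apply: fn0; rewrite -ef fa mulrA ee.
Qed.

Lemma regular (x : A) : exists y : A, x * y * x = x.
Proof.
have [e [[y ->] _ ex]] := right_ideal_generator (right_ideal_principal x).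
by exists y; apply: ex; exists 1; rewrite mulr1.
Qed.

(** For [z = x - x * e] one has [z * e = 0], while [y * z] lies in [I] and is fixed by [e] on the
    left; so [z * y * z = 0] for all [y]. *)
Lemma two_sided_identity I : right_ideal I -> (forall a x, I x -> I (a * x)) ->
  exists e, [/\ I e, forall x, I x -> e * x = x & forall x, I x -> x * e = x].
Proof.
move=> rI lI; have [e [Ie ee ex]] := right_ideal_generator rI.
case: (rI) => _ _ IM.
exists e; split=> // x Ix; apply/esym/subr0_eq; apply: semiprime => y.
set z := x - x * e.
have Iz : I z by apply: right_idealB => //; apply: IM.
have ze : z * e = 0 by rewrite /z mulrBl -[x * e * e]mulrA ee subrr.
by rewrite -mulrA -(ex (y * z)) ?mulrA ?ze ?mul0r //; apply: lI.
Qed.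

(** The descending chain of right ideals generated by the powers of [x] stops, and powers of [y]
    cancel those of [x] on the left. *)
Lemma dedekind_finite (x y : A) : y * x = 1 -> x * y = 1.
Proof.
move=> yx.
have yxk k : y ^+ k * x ^+ k = 1.
  elim: k => [|k IH]; first by rewrite !expr0 mulr1.
  by rewrite exprSr exprS mulrA -(mulrA _ y) yx mulr1.
have [|k _ mink] := @exists_minimizer nat (fun=> True) (fun k => mu (principal (x ^+ k))).
  by exists 0.
have : principal (x ^+ k) `<=` principal (x ^+ k.+1).
  apply: mu_strict; try exact: right_ideal_principal.
    by move=> _ [a ->]; exists (x * a); rewrite exprSr mulrA.
  exact: mink.
move=> /(_ (x ^+ k))[]; first by exists 1; rewrite mulr1.
move=> a /(congr1 (fun b => y ^+ k * b)); rewrite yxk exprSr !mulrA yxk mul1r => xa.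
by have -> : y = a; rewrite -?xa // -[y]mulr1 xa mulrA yx mul1r.
Qed.

(* The witness [c] can be taken in any additive [C] of which every element of
   [A] is a multiple by a central unit: think of an order in [A]. *)
Theorem unit_completion (C : set A) (alpha eta a x y z w : A) :
  C 0 -> (forall b c, C b -> C c -> C (b + c)) ->
  (forall b, exists s v, [/\ forall t, s * t = t * s, s * v = 1 & C (s * b)]) ->
  alpha * x + eta * y = 1 -> z * alpha + w * a = 1 ->
  exists c u, [/\ C c, u * (alpha + eta * c * a) = 1 &
    (alpha + eta * c * a) * u = 1].
Proof.
move=> C0 CD Cdense right_uni left_uni.
have [||c Cc maxc] := @exists_maximizer A C
    (fun c => mu (principal (alpha + eta * c * a))) n.
- by move=> *; apply: mu_bounded.
- by exists 0.
exists c; move: maxc; set al := alpha + eta * c * a => maxc.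
(* Both relations survive the passage from [alpha] to [al], with new coefficients. So [c] can be
   taken to be 0, and maximality says that no further [c'] enlarges [principal al]. *)
have {}right_uni : al * x + eta * (y - c * a * x) = 1.
  by rewrite -right_uni /al mulrDl mulrBr !mulrA addrACA subrr addr0.
have {}left_uni : z * al + (w - z * eta * c) * a = 1.
  by rewrite -left_uni /al mulrDr mulrBl !mulrA addrACA subrr addr0.
move: (y - _) (w - _) right_uni left_uni => {}y {}w right_uni left_uni.
have {}maxc c' : C c' -> principal al `<=` principal (al + eta * c' * a) ->
    principal (al + eta * c' * a) `<=` principal al.
  move=> Cc' sub; apply: mu_strict sub _; try exact: right_ideal_principal.
  by have := maxc (c + c') (CD _ _ Cc Cc'); rewrite mulrDr mulrDl addrA.
clearbody al.
pose K := [set k | al * k = 0].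
have rK : right_ideal K.
  split; first by rewrite /K /= mulr0.
    by move=> u v alu alv; rewrite /K /= mulrDr alu alv addr0.
  by move=> u b alu; rewrite /K /= mulrA alu mul0r.
(* The right annihilator of [al] is generated by the idempotent [eps]; the aim is [eps = 0]. *)
have [eps [Ke ee eK]] := right_ideal_generator rK.
have ewae : eps = w * a * eps.
  by rewrite -{1}[eps]mul1r -left_uni mulrDl -mulrA Ke mulr0 add0r.
(* Here [e'] is an idempotent killed by [al], so adding [eta * (s * c') * e'] to [al] cannot lose
   any of [principal al]. By maximality nothing is gained either, and multiplication by [eps] gives
   the claim. The central unit [s] brings the coefficient [d] into [C] and is divided out at the
   end. *)
have eta_eps c' : principal al (eta * (c' * eps)).
  pose e' := eps * w * a.
  have ale' : al * e' = 0 by rewrite /e' !mulrA Ke !mul0r.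
  have e'e' : e' * e' = e'.
    have -> : e' * e' = eps * (w * a * eps) * (w * a) by rewrite /e' !mulrA.
    by rewrite -ewae ee /e' mulrA.
  have e'e : e' * eps = eps.
    have -> : e' * eps = eps * (w * a * eps) by rewrite /e' !mulrA.
    by rewrite -ewae ee.
  have [s [v [sC sv Cd]]] := Cdense (c' * (eps * w)).
  set d := s * _ in Cd.
  have da : d * a = s * c' * e' by rewrite /d /e' !mulrA.
  have E : al + eta * d * a = al + eta * (s * c') * e' by rewrite -mulrA da mulrA.
  have /(maxc d Cd) sub : principal al `<=` principal (al + eta * d * a).
    move=> _ [b ->]; exists ((1 - e') * b); rewrite E [RHS]mulrA; congr (_ * b).
    by rewrite mulrBr mulr1 mulrDl ale' add0r -(mulrA _ e') e'e' addrK.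
  have : principal al (eta * (s * c') * eps).
    apply: sub; exists eps; rewrite E mulrDl Ke add0r.
    by rewrite -(mulrA _ e') e'e.
  move=> [b eb]; exists (b * v); rewrite [RHS]mulrA -eb sC -!mulrA (sC (eps * v)).
  by rewrite -(mulrA eps) -sC sv mulr1.
(* The two-sided ideal generated by [eps]. Since [eta] maps it into [principal al], the relation
   [right_uni] puts its identity [e] there too. *)
pose I := [set t | exists (k : nat) (u v : nat -> A), t = \sum_(i < k) u i * eps * v i].
have rI : right_ideal I.
  split; first by exists 0, (fun=> 0), (fun=> 0); rewrite big_ord0.
    move=> _ _ [k [u [v ->]]] [k' [u' [v' ->]]].
    exists (k + k')%N, (fun i => if (i < k)%N then u i else u' (i - k)%N),
       (fun i => if (i < k)%N then v i else v' (i - k)%N).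
    rewrite big_split_ord /=; congr (_ + _); apply: eq_bigr => i _.
      by rewrite ltn_ord.
    by rewrite ltnNge leq_addr /= addKn.
  move=> _ b [k [u [v ->]]]; exists k, u, (fun i => v i * b).
  by rewrite mulr_suml; apply: eq_bigr => i _; rewrite !mulrA.
have lI b t : I t -> I (b * t).
  move=> [k [u [v ->]]]; exists k, (fun i => b * u i), v.
  by rewrite mulr_sumr; apply: eq_bigr => i _; rewrite !mulrA.
have Ieps : I eps.
  by exists 1%N, (fun=> 1), (fun=> 1); rewrite big_ord1 mul1r mulr1.
have [al0 alD alM] := right_ideal_principal al.
have etaI t : I t -> principal al (eta * t).
  move=> [k [u [v ->]]]; rewrite mulr_sumr; apply: big_ind => // i _.
  by rewrite mulrA; apply: alM.
have [e [Ie eI Ie']] := two_sided_identity rI lI.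
have [u eu] : principal al e.
  rewrite -[e]mul1r -right_uni mulrDl -!mulrA; apply: alD.
    by exists (x * e).
  by apply: etaI; apply: lI.
have central b : b * e = e * b.
  case: (rI) => _ _ IM.
  by rewrite -(eI _ (lI b _ Ie)) -[RHS](Ie' _ (IM _ b Ie)) mulrA.
(* In the ring factor cut out by the central idempotent [e], [al] has a right inverse, hence is a
   unit by Dedekind finiteness; but it kills [eps], which lies in that factor. *)
have eps0 : eps = 0.
  pose v := u * e.
  have ve : v * e = v by rewrite /v -mulrA eI.
  have alv : al * v = e by rewrite /v mulrA -eu eI.
  pose f := 1 - e.
  have ef : e * f = 0 by rewrite mulrBr mulr1 eI // subrr.
  have fe : f * eps = 0 by rewrite mulrBl mul1r eI // subrr.
  have fv : f * v = 0 by rewrite -ve central mulrA mulrBl mul1r eI // subrr mul0r.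
  have ff : f * f = f by rewrite {1}/f mulrBl mul1r ef subr0.
  have efD : e + f = 1 by rewrite subrKC.
  clearbody f.
  have : (al * e + f) * (v + f) = 1.
    rewrite mulrDl !mulrDr fv add0r -(mulrA al e v) -(mulrA al e f) ef mulr0.
    by rewrite addr0 -central ve alv ff.
  move=> /dedekind_finite /(congr1 (fun b => b * eps)); rewrite mul1r -mulrA.
  by rewrite [X in _ * X]mulrDl -(mulrA al) eI // Ke fe addr0 mulr0 => <-.
have inj t : al * t = 0 -> t = 0 by move=> /eK; rewrite eps0 mul0r.
have [b alb] := regular al.
have bal : b * al = 1.
  by apply/subr0_eq/inj; rewrite mulrBr mulrA alb mulr1 subrr.
by exists b; split=> //; apply: dedekind_finite.
Qed.

End SemiprimeFiniteLength.

(** * The quotient by the Jacobson radical *)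

Section JacobsonRadical.
Local Open Scope quotient_scope.
Variable B : pzRingType.
Implicit Types x y u : B.

(** The elementwise form of the intersection of the maximal left ideals. *)
Definition jacobson : set B := [set x | forall y, exists u, u * (1 + y * x) = 1].

Lemma jacobsonD x x' : jacobson x -> jacobson x' -> jacobson (x + x').
Proof.
move=> Jx Jx' y; have [u ux] := Jx y; have [v vx] := Jx' (u * y).
by exists (v * u); rewrite (mulrDr y) addrA -mulrA mulrDr ux mulrA.
Qed.

Lemma jacobsonMl y x : jacobson x -> jacobson (y * x).
Proof. by move=> Jx z; rewrite mulrA; apply: Jx. Qed.

Lemma jacobsonMr x z : jacobson x -> jacobson (x * z).
Proof.
move=> Jx y; have [v vx] := Jx (z * y).
(* The usual passage from a left inverse of 1 + z (y x) to one of 1 + (y x) z. *)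
exists (1 - y * x * v * z).
have e : v * z * (1 + y * (x * z)) = z.
  transitivity (v * (1 + z * y * x) * z); last by rewrite vx mul1r.
  by rewrite -!mulrA; congr (v * _); rewrite mulrDr mulr1 mulrDl mul1r !mulrA.
by rewrite mulrBl mul1r -(mulrA _ v) -(mulrA _ (v * z)) e mulrA addrK.
Qed.

Lemma jacobsonN x : jacobson x -> jacobson (- x).
Proof. by move=> Jx; rewrite -mulN1r; apply: jacobsonMl. Qed.

Lemma jacobson0 : jacobson 0.
Proof. by move=> y; exists 1; rewrite mulr0 addr0 mulr1. Qed.

Lemma jacobson_unit x : jacobson x -> exists u, u * (1 + x) = 1 /\ (1 + x) * u = 1.
Proof.
move=> Jx; have [u] := Jx 1; rewrite mul1r => ux; exists u; split=> //.
have [v] := Jx (- u).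
have -> : 1 + - u * x = u.
  by move: ux; rewrite mulrDr mulr1 mulNr => <-; rewrite addrK.
move=> vu; have := congr1 (fun b => b * (1 + x)) vu.
by rewrite -mulrA ux mulr1 mul1r => <-.
Qed.

Definition jac_equiv x y : bool := `[< jacobson (x - y) >].

Lemma jac_equiv_is_equiv : equiv_class_of jac_equiv.
Proof.
split=> [x | x y | y x z].
- by apply/asboolP; rewrite subrr; apply: jacobson0.
- by apply: asbool_equiv_eq; split=> /jacobsonN; rewrite opprB.
- move=> /asboolP Jxy /asboolP Jyz; apply/asboolP.
  by rewrite -(subrKA y); apply: jacobsonD.
Qed.

Canonical jac_equiv_equiv := EquivRelPack jac_equiv_is_equiv.

Definition jac_quot : Type := {eq_quot jac_equiv}.
HB.instance Definition _ := Choice.on jac_quot.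

Definition jac_proj x : jac_quot := \pi_{eq_quot jac_equiv} x.

Lemma jac_projP x y : jac_proj x = jac_proj y <-> jacobson (x - y).
Proof. by split=> [/eqmodP/asboolP // | H]; exact/eqmodP/asboolP. Qed.

Lemma jac_proj_surj (a : jac_quot) : exists x, a = jac_proj x.
Proof. by exists (repr (a : {eq_quot jac_equiv})); rewrite /jac_proj reprK. Qed.

Definition jac_repr (a : jac_quot) : B := repr (a : {eq_quot jac_equiv}).

Lemma jac_reprK a : jac_proj (jac_repr a) = a.
Proof. by rewrite /jac_proj reprK. Qed.

Definition jac_add a b := jac_proj (jac_repr a + jac_repr b).
Definition jac_opp a := jac_proj (- jac_repr a).
Definition jac_mul a b := jac_proj (jac_repr a * jac_repr b).

Lemma jac_addE x y : jac_add (jac_proj x) (jac_proj y) = jac_proj (x + y).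
Proof.
apply/jac_projP; rewrite opprD addrACA.
by apply: jacobsonD; apply/jac_projP; rewrite jac_reprK.
Qed.

Lemma jac_oppE x : jac_opp (jac_proj x) = jac_proj (- x).
Proof.
apply/jac_projP; rewrite -opprD; apply: jacobsonN.
by apply/jac_projP; rewrite jac_reprK.
Qed.

Lemma jac_mulE x y : jac_mul (jac_proj x) (jac_proj y) = jac_proj (x * y).
Proof.
apply/jac_projP; set x' := jac_repr _; set y' := jac_repr _.
have -> : x' * y' - x * y = (x' - x) * y' + x * (y' - y).
  by rewrite mulrBl mulrBr addrA subrK.
by apply: jacobsonD; [apply: jacobsonMr | apply: jacobsonMl];
  apply/jac_projP; rewrite jac_reprK.
Qed.

Let jac_addA : associative jac_add.
Proof.
move=> a b c; have [x ->] := jac_proj_surj a; have [y ->] := jac_proj_surj b.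
by have [z ->] := jac_proj_surj c; rewrite !jac_addE addrA.
Qed.

Let jac_addC : commutative jac_add.
Proof.
move=> a b; have [x ->] := jac_proj_surj a; have [y ->] := jac_proj_surj b.
by rewrite !jac_addE addrC.
Qed.

Let jac_add0 : left_id (jac_proj 0) jac_add.
Proof. by move=> a; have [x ->] := jac_proj_surj a; rewrite jac_addE add0r. Qed.

Let jac_addN : left_inverse (jac_proj 0) jac_opp jac_add.
Proof.
by move=> a; have [x ->] := jac_proj_surj a; rewrite jac_oppE jac_addE addNr.
Qed.

HB.instance Definition _ :=
  GRing.isZmodule.Build jac_quot jac_addA jac_addC jac_add0 jac_addN.

Let jac_mulA : associative jac_mul.
Proof.
move=> a b c; have [x ->] := jac_proj_surj a; have [y ->] := jac_proj_surj b.
by have [z ->] := jac_proj_surj c; rewrite !jac_mulE mulrA.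
Qed.

Let jac_mul1l : left_id (jac_proj 1) jac_mul.
Proof. by move=> a; have [x ->] := jac_proj_surj a; rewrite jac_mulE mul1r. Qed.

Let jac_mul1r : right_id (jac_proj 1) jac_mul.
Proof. by move=> a; have [x ->] := jac_proj_surj a; rewrite jac_mulE mulr1. Qed.

Let jac_mulDl : left_distributive jac_mul +%R.
Proof.
move=> a b c; have [x ->] := jac_proj_surj a; have [y ->] := jac_proj_surj b.
have [z ->] := jac_proj_surj c.
by rewrite [X in jac_mul X _]jac_addE !jac_mulE [RHS]jac_addE mulrDl.
Qed.

Let jac_mulDr : right_distributive jac_mul +%R.
Proof.
move=> a b c; have [x ->] := jac_proj_surj a; have [y ->] := jac_proj_surj b.
have [z ->] := jac_proj_surj c.
by rewrite [X in jac_mul _ X]jac_addE !jac_mulE [RHS]jac_addE mulrDr.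
Qed.

HB.instance Definition _ := GRing.Zmodule_isPzRing.Build jac_quot
  jac_mulA jac_mul1l jac_mul1r jac_mulDl jac_mulDr.

Lemma jac_projD x y : jac_proj (x + y) = jac_proj x + jac_proj y.
Proof. by rewrite -jac_addE. Qed.

Lemma jac_projM x y : jac_proj (x * y) = jac_proj x * jac_proj y.
Proof. by rewrite -jac_mulE. Qed.


Lemma jac_proj0 x : jac_proj x = 0 <-> jacobson x.
Proof. by rewrite -[x in jacobson x]subr0; exact: jac_projP. Qed.

(** If x y x lies in the radical, then 1 - y x y x has a left inverse, and it factors as (1 - y x)
    (1 + y x). *)
Lemma jac_quot_semiprime (a : jac_quot) : (forall b, a * b * a = 0) -> a = 0.
Proof.
have [x ->] := jac_proj_surj a => xyx; apply/jac_proj0 => y.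
have : jacobson (x * y * x) by apply/jac_proj0; rewrite !jac_projM.
move=> /(_ (- y))[u uy]; exists (u * (1 - y * x)).
rewrite -mulrA -[RHS]uy; congr (u * _).
by rewrite mulrBl mul1r mulrDr mulr1 opprD addrA addrK mulNr !mulrA.
Qed.

Lemma jac_proj_lift_unit x (a : jac_quot) :
  a * jac_proj x = 1 -> jac_proj x * a = 1 -> exists u, u * x = 1 /\ x * u = 1.
Proof.
have [y ->] := jac_proj_surj a; rewrite -!jac_projM.
move=> /jac_projP/jacobson_unit[u]; rewrite subrKC => -[uyx _].
move=> /jac_projP/jacobson_unit[v]; rewrite subrKC => -[_ xyv].
exists (u * y); rewrite -mulrA; split=> //.
have <- : y * v = u * y.
  by rewrite -[LHS]mul1r -uyx -!mulrA (mulrA x) xyv mulr1.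
by rewrite mulrA.
Qed.

End JacobsonRadical.

(** * A substitute for dimension in algebras spanned by finitely many elements over a field *)

Section LeadingIndices.
Variables (R : comPzRingType) (A : pzRingType) (theta : {rmorphism R -> A}).
Hypothesis theta_central : forall r a, theta r * a = a * theta r.
Hypothesis theta_field : forall r, theta r = 0 \/ exists u, theta r * u = 1.
Variables (n : nat) (e : nat -> A).
Hypothesis span_e : forall a, exists s (r : nat -> R),
  (exists u, theta s * u = 1) /\ theta s * a = \sum_(i < n) theta (r i) * e i.

(** The pivots of an echelon form. The [e i] may be dependent, in which case there can be more
    pivots than the dimension; the count still separates nested right ideals. *)
Definition leading (U : set A) (i : nat) : Prop := exists r : nat -> R,
  (exists u, theta (r i) * u = 1) /\ U (\sum_(j < i.+1) theta (r j) * e j).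

Definition leading_count (U : set A) : nat := #|[set i : 'I_n | `[< leading U i >]]%SET|.

Lemma leading_count_bounded U : (leading_count U <= n)%N.
Proof. by rewrite -[leqRHS]card_ord max_card. Qed.

(** Equal counts give equal sets of pivots, so elements of [V] are reduced to 0 by elements of [U],
    from the highest index down. *)
Lemma leading_count_strict U V : right_ideal U -> right_ideal V ->
  U `<=` V -> (leading_count V <= leading_count U)%N -> V `<=` U.
Proof.
move=> rU rV UV cVU; have [U0 UD UM] := rU; have [V0 VD VM] := rV.
have lead i : (i < n)%N -> leading V i -> leading U i.
  move=> lt_in lVi.
  have sUV : [set i : 'I_n | `[< leading U i >]]%SET \subset
      [set i : 'I_n | `[< leading V i >]]%SET.
    apply/fintype.subsetP => j; rewrite !inE => -[r [inv_r Ur]].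
    by exists r; split=> //; apply: (UV _ Ur).
  have /eqP eUV : [set i : 'I_n | `[< leading U i >]]%SET ==
      [set i : 'I_n | `[< leading V i >]]%SET.
    by rewrite eqEcard sUV.
  have : Ordinal lt_in \in [set i : 'I_n | `[< leading V i >]]%SET.
    by rewrite !inE.
  by rewrite -eUV !inE.
have cancel_unit s a : (exists u, theta s * u = 1) -> U (theta s * a) -> U a.
  move=> [u su] Usa; have -> : a = theta s * a * u.
    by rewrite theta_central -mulrA su mulr1.
  exact: UM.
have main k : (k <= n)%N -> forall r : nat -> R,
    V (\sum_(i < k) theta (r i) * e i) -> U (\sum_(i < k) theta (r i) * e i).
  elim: k => [_ r _|k IH lt_kn r]; first by rewrite big_ord0.
  have [r0|r_unit Vr] := theta_field (r k).
    by rewrite big_ord_recr /= r0 mul0r addr0; apply: IH (ltnW lt_kn) r.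
  have [|s [s_unit Us]] := lead k lt_kn; first by exists r.
  apply: (cancel_unit (s k)) => //.
  set x := \sum_(i < k.+1) _ in Vr *.
  set y := \sum_(j < k.+1) _ in Us.
  (* Cross-multiplication: the inverses of the pivots lie in [A] only, and the coefficients have to
     stay in the image of [R]. *)
  have -> : theta (s k) * x = (theta (s k) * x - y * theta (r k)) + y * theta (r k).
    by rewrite subrK.
  apply: UD; last exact: UM.
  have E : theta (s k) * x - y * theta (r k) =
      \sum_(i < k) theta (s k * r i - r k * s i) * e i.
    rewrite -theta_central /x /y !mulr_sumr !big_ord_recr /= !mulrA -!rmorphM.
    rewrite (mulrC (r k)) opprD addrACA subrr addr0 -sumrB.
    by apply: eq_bigr => i _; rewrite !mulrA -!rmorphM rmorphB mulrBl.
  rewrite E; apply: (IH (ltnW lt_kn) (fun i => s k * r i - r k * s i)).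
  rewrite -E.
  apply: right_idealB => //; first by rewrite theta_central; apply: VM.
  by apply: VM; apply: (UV _ Us).
move=> a Va; have [s [r [s_unit sa]]] := span_e a.
apply: (cancel_unit s) => //; rewrite sa; apply: (main n) => //.
by rewrite -sa theta_central; apply: VM.
Qed.

End LeadingIndices.

(** * Noetherian rings and modules *)

Section Span.
Variable T : pzRingType.

Definition submodule (V : lmodType T) (U : set V) : Prop :=
  [/\ U 0, forall x y, U x -> U y -> U (x + y) & forall r x, U x -> U (r *: x)].

Fixpoint lspan (V : lmodType T) (l : seq V) : set V :=
  if l is x :: l' then [set y | exists r z, lspan l' z /\ y = r *: x + z]
  else [set 0].

Variable V : lmodType T.
Implicit Types (l : seq V) (U : set V).

Lemma submoduleB U x y : submodule U -> U x -> U y -> U (x - y).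
Proof. by move=> [_ UD UZ] Ux Uy; apply: UD => //; rewrite -scaleN1r; apply: UZ. Qed.

Lemma submodule_sum U n (f : 'I_n -> V) : submodule U -> (forall i, U (f i)) ->
  U (\sum_(i < n) f i).
Proof. by move=> [U0 UD _] Uf; apply: big_ind. Qed.

Lemma lspan_submodule l : submodule (lspan l).
Proof.
elim: l => [|x l [l0 lD lZ]] /=.
  split=> //; first by move=> x y -> ->; rewrite /= addr0.
  by move=> r x ->; rewrite /= scaler0.
split; first by exists 0, 0; rewrite scale0r addr0.
  move=> _ _ [r [y [ly ->]]] [s [z [lz ->]]]; exists (r + s), (y + z).
  by split; [apply: lD | rewrite scalerDl addrACA].
move=> s _ [r [y [ly ->]]]; exists (s * r), (s *: y).
by split; [apply: lZ | rewrite scalerDr scalerA].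
Qed.

Lemma lspan_mem l x : x \in l -> lspan l x.
Proof.
elim: l => // y l IH; rewrite inE => /orP[/eqP ->|/IH lx] /=.
  by exists 1, 0; split; [case: (lspan_submodule l) | rewrite scale1r addr0].
by exists 0, x; rewrite scale0r add0r.
Qed.

Lemma lspan_sub l U : submodule U -> (forall x, x \in l -> U x) -> lspan l `<=` U.
Proof.
move=> [U0 UD UZ]; elim: l => [|x l IH] Ul /=; first by move=> _ ->.
move=> _ [r [z [lz ->]]]; apply: UD.
  by apply: UZ; apply: Ul; rewrite mem_head.
by apply: IH lz => y ly; apply: Ul; rewrite inE ly orbT.
Qed.

Lemma lspanT_finitely_generated : finitely_generated V <-> exists l, lspan l = setT.
Proof.
split=> [[n [g gP]]|[l lT]].
  exists [seq g i | i <- enum 'I_n]; apply/seteqP; split=> // x _.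
  have [c ->] := gP x; apply: submodule_sum => [|i]; first exact: lspan_submodule.
  have [_ _ lZ] := lspan_submodule [seq g i | i <- enum 'I_n].
  by apply: lZ; apply: lspan_mem; apply: map_f; rewrite mem_enum.
exists (size l), (fun i => l`_i) => x.
have {lT} : lspan l x by rewrite lT.
elim: l x => [|y l IH] x /=; first by move->; exists (fun=> 0); rewrite big_ord0.
move=> [r [z [lz ->]]]; have [c ->] := IH _ lz.
exists (fun i : 'I_(size l).+1 => if unlift ord0 i is Some j then c j else r).
rewrite big_ord_recl unlift_none; congr (_ + _).
by apply: eq_bigr => i _; rewrite liftK.
Qed.

End Span.

Lemma finitely_generated_ffun (T : pzRingType) (V : lmodType T) n :
  finitely_generated V -> finitely_generated {ffun 'I_n -> V}.
Proof.
move=> /lspanT_finitely_generated[l lT]; apply/lspanT_finitely_generated.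
pose d (i : 'I_n) (x : V) : {ffun 'I_n -> V} := [ffun j => if j == i then x else 0].
pose k := [seq d i x | i <- enum 'I_n, x <- l].
exists k; apply/seteqP; split=> // f _.
have sk := lspan_submodule k; have [k0 kD kZ] := sk.
have -> : f = \sum_(i < n) d i (f i).
  apply/ffunP => j; rewrite sum_ffunE (bigD1 j) //= ffunE eqxx.
  by rewrite big1 ?addr0 // => i /negPf ij; rewrite ffunE eq_sym ij.
apply: (submodule_sum sk) => i.
have : lspan l (f i) by rewrite lT.
apply: (@lspan_sub _ _ l (fun x => lspan k (d i x))).
  split.
  - by have -> : d i 0 = 0 by apply/ffunP => j; rewrite !ffunE if_same.
  - move=> x y lx ly; have -> : d i (x + y) = d i x + d i y.
      by apply/ffunP => j; rewrite !ffunE; case: eqP; rewrite ?addr0.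
    exact: kD.
  - move=> r x lx; have -> : d i (r *: x) = r *: d i x.
      by apply/ffunP => j; rewrite !ffunE; case: eqP; rewrite ?scaler0.
    exact: kZ.
move=> x lx; apply: lspan_mem; apply/allpairsP; exists (i, x).
by rewrite mem_enum.
Qed.

Section Noetherian.
Variable R : comPzRingType.

Lemma noetherian_submodule (V : lmodType R) (l : seq V) (U : set V) :
  noetherian R -> submodule U -> U `<=` lspan l ->
  exists l', lspan l' = U.
Proof.
move=> noethR; elim: l U => [|x l IH] U sU Ul; have [U0 UD UZ] := sU.
  by exists [::]; apply/seteqP; split=> // y /= ->.
have sl := lspan_submodule l; have [l0 lD lZ] := sl.
(* The coefficients at [x] of the elements of [U]. Finitely many elements of [U] realize generators
   of this ideal, and subtracting them leaves an element of [U] in the span of [l]. *)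
pose I := [set r : R | exists y, lspan l y /\ U (r *: x + y)].
have [|n [g gP]] := noethR I.
  split; first by exists 0; rewrite scale0r addr0.
    move=> r s [y [ly Uy]] [z [lz Uz]]; exists (y + z).
    by split; [apply: lD | rewrite scalerDl addrACA; apply: UD].
  move=> s r [y [ly Uy]]; exists (s *: y); split; first exact: lZ.
  by rewrite -scalerA -scalerDr; apply: UZ.
have /choice[y yP] : forall i, exists y, lspan l y /\ U (g i *: x + y).
  move=> i; have : I (g i).
    rewrite gP; exists (fun j => (j == i)%:R).
    rewrite (bigD1 i) //= eqxx mul1r big1 ?addr0 // => j /negPf ->.
    by rewrite mul0r.
  by [].
have sUl : submodule (U `&` lspan l).
  split=> //; first by move=> u v [Uu lu] [Uv lv]; split; [apply: UD | apply: lD].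
  by move=> r u [Uu lu]; split; [apply: UZ | apply: lZ].
have [l' l'P] := IH _ sUl (@subIsetr _ _ _).
pose u i := g i *: x + y i.
exists ([seq u i | i <- enum 'I_n] ++ l'); apply/seteqP; split.
  apply: lspan_sub => // v; rewrite mem_cat => /orP[/mapP[i _ ->]|].
    by case: (yP i).
  by move=> /lspan_mem; rewrite l'P => -[].
set L := _ ++ _; have sL := lspan_submodule L; have [L0 LD LZ] := sL.
move=> v Uv; have [r [z [lz vE]]] := Ul _ Uv.
have [c rE] : [set r | exists c : 'I_n -> R, r = \sum_(i < n) c i * g i] r.
  by rewrite -gP; exists z; rewrite -vE.
rewrite -[v](subrK (\sum_(i < n) c i *: u i)); apply: LD; last first.
  apply: submodule_sum => // i; apply: LZ; apply: lspan_mem.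
  by rewrite mem_cat map_f ?mem_enum.
have l'L : lspan l' `<=` lspan L.
  by apply: lspan_sub => // w lw; apply: lspan_mem; rewrite mem_cat lw orbT.
apply: l'L; rewrite l'P; split.
  apply: submoduleB => //; apply: submodule_sum => // i.
  by apply: UZ; case: (yP i).
have -> : v - \sum_(i < n) c i *: u i = z - \sum_(i < n) c i *: y i.
  rewrite vE rE scaler_suml; under [X in _ - X = _]eq_bigr => i _.
    by rewrite /u scalerDr scalerA; over.
  by rewrite big_split /= opprD addrACA subrr add0r.
apply: submoduleB => //; apply: submodule_sum => // i.
by apply: lZ; case: (yP i).
Qed.

Lemma finitely_generated_inj (V W : lmodType R) (f : {linear W -> V}) :
  noetherian R -> finitely_generated V -> injective f -> finitely_generated W.
Proof.
move=> noethR /lspanT_finitely_generated[l lT] f_inj.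
apply/lspanT_finitely_generated.
have s_im : submodule (range f).
  split; first by exists 0; rewrite ?linear0.
    by move=> _ _ [x _ <-] [y _ <-]; exists (x + y); rewrite ?linearD.
  by move=> r _ [x _ <-]; exists (r *: x); rewrite ?linearZ.
have [|l' l'P] := @noetherian_submodule V l _ noethR s_im; first by rewrite lT.
have [k kP] : exists k, map f k = l'.
  have : forall y, y \in l' -> range f y by rewrite -l'P => y /lspan_mem.
  elim: {l'P} l' => [|y l' IH] l'f; first by exists [::].
  have [|k kP] := IH; first by move=> z lz; apply: l'f; rewrite inE lz orbT.
  have [x _ xy] := l'f y (mem_head _ _).
  by exists (x :: k); rewrite /= xy kP.
exists k; apply/seteqP; split=> // x _.
have : lspan l' (f x) by rewrite l'P; exists x.
rewrite -kP; elim: k x {kP} => [|y k IH] x /=.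
  by move=> fx0; apply: f_inj; rewrite fx0 linear0.
move=> [r [z [lz fxE]]]; exists r, (x - r *: y); split; last by rewrite subrKC.
by apply: IH; rewrite linearB linearZ /= fxE addrAC subrr add0r.
Qed.

Lemma noetherian_ind (P : set R -> Prop) : noetherian R ->
  (forall I, ideal I ->
    (forall J, ideal J -> I `<=` J -> ~ J `<=` I -> P J) -> P I) ->
  forall I, ideal I -> P I.
Proof.
move=> noethR ind I0 idI0; apply: contrapT => nPI0.
pose T := {I : set R | ideal I /\ ~ P I}.
have next (t : T) : exists u : T, sval t `<=` sval u /\ ~ sval u `<=` sval t.
  case: t => I [idI nPI] /=; apply: contrapT => none; apply: nPI.
  apply: ind => // J idJ IJ nJI; apply: contrapT => nPJ.
  by apply: none; exists (exist _ J (conj idJ nPJ)).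
have [nx nxP] := choice next.
pose f i := iter i nx (exist _ I0 (conj idI0 nPI0)).
have fS i : sval (f i) `<=` sval (f i.+1) /\ ~ sval (f i.+1) `<=` sval (f i).
  exact: nxP.
have mono i j : (i <= j)%N -> sval (f i) `<=` sval (f j).
  elim: j => [|j IH]; first by rewrite leqn0 => /eqP ->.
  rewrite leq_eqVlt => /orP[/eqP -> //|/IH]; move/subset_trans; apply.
  by case: (fS j).
have fid i : ideal (sval (f i)) by case: (svalP (f i)).
have [|n [g gP]] := noethR (\bigcup_i sval (f i)).
  split; first by exists 0%N => //; case: (fid 0%N).
    move=> x y [i _ fx] [j _ fy]; exists (maxn i j) => //.
    have [_ fD _] := fid (maxn i j).
    by apply: fD; [apply: mono fx | apply: mono fy]; rewrite ?leq_maxl ?leq_maxr.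
  by move=> r x [i _ fx]; exists i => //; have [_ _ fM] := fid i; apply: fM.
have /choice[k kP] : forall i, exists k, sval (f k) (g i).
  move=> i; have [k _ fk] : (\bigcup_i sval (f i)) (g i); last by exists k.
  rewrite gP; exists (fun j => (j == i)%:R).
  rewrite (bigD1 i) //= eqxx mul1r big1 ?addr0 // => j /negPf ->.
  by rewrite mul0r.
pose m := \max_i k i.
have [_] := fS m; apply => x fx.
have : (\bigcup_i sval (f i)) x by exists m.+1.
rewrite gP => -[c ->]; have [f0 fD fM] := fid m.
by apply: big_ind => // i _; apply: fM; apply: mono (kP i); apply: leq_bigmax.
Qed.

Lemma exists_maximal_ideal (I : set R) : noetherian R -> ideal I -> ~ I 1 ->
  exists2 m, maximal_ideal m & I `<=` m.
Proof.
move=> noethR; move: I; apply: noetherian_ind => // I idI IH nI1.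
have [maxI|nmax] := pselect (maximal_ideal I); first by exists I.
have [J [idJ IJ JI JT]] : exists J, [/\ ideal J, I `<=` J, J <> I & J <> setT].
  apply: contrapT => none; apply: nmax; split=> // J idJ IJ.
  have [JI|nJI] := pselect (J = I); first by left.
  by right; apply: contrapT => nJT; apply: none; exists J.
have nJ1 : ~ J 1.
  move=> J1; apply: JT; apply/seteqP; split=> // x _.
  by have [_ _ JM] := idJ; rewrite -[x]mulr1; apply: JM.
have [|m maxm Jm] := IH J idJ IJ _ nJ1.
  by move=> nJI; apply: JI; apply/seteqP.
by exists m => //; apply: subset_trans Jm.
Qed.

Lemma maximal_prime (m : set R) : maximal_ideal m -> prime_ideal m.
Proof.
move=> [idm nm1 maxm]; have [m0 mD mM] := idm; split=> // x y mxy.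
have [mx|nmx] := pselect (m x); [by left | right].
pose J := [set a | exists u r, m u /\ a = u + r * x].
have idJ : ideal J.
  split; first by exists 0, 0; rewrite mul0r addr0.
    move=> _ _ [u [r [mu ->]]] [v [s [mv ->]]]; exists (u + v), (r + s).
    by split; [apply: mD | rewrite mulrDl addrACA].
  move=> s _ [u [r [mu ->]]]; exists (s * u), (s * r).
  by split; [apply: mM | rewrite mulrDr mulrA].
have mJ : m `<=` J by move=> u mu; exists u, 0; rewrite mul0r addr0.
have Jx : J x by exists 0, 1; rewrite mul1r add0r.
have [JE|JT] := maxm J idJ mJ; first by rewrite -JE in nmx.
have [u [r [mu e]]] : J 1 by rewrite JT.
rewrite -[y]mul1r e mulrDl; apply: mD; first by rewrite mulrC; apply: mM.
by rewrite -mulrA; apply: mM.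
Qed.

End Noetherian.

(** * Module-finite algebras at a prime *)

Section ModuleFiniteAlgebra.
Variables (R : comPzRingType) (E : pzRingType) (phi : algebra_on R E).
Hypothesis noethR : noetherian R.
Hypothesis E_finite : module_finite phi.

Lemma phiC r (x : E) : x * phi r = phi r * x.
Proof. by rewrite alg_map_central. Qed.

Lemma restrict_regularZ r (x : Defs.restrict phi (E^c)^o) : r *: x = (phi r * (x : E))%R.
Proof. exact: phiC. Qed.

Lemma module_finite_generators : exists n (e : nat -> E), forall x,
  exists r : nat -> R, x = \sum_(i < n) phi (r i) * e i.
Proof.
have [n [g gP]] := E_finite; exists n.
exists (fun i => if insub i is Some j then (g j : E) else 0) => x.
have [c xE] := gP (x : Defs.restrict phi (E^c)^o).
exists (fun i => if insub i is Some j then c j else 0); rewrite [LHS]xE.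
by apply: eq_bigr => i _; rewrite valK; exact: restrict_regularZ.
Qed.

(** All powers of [z] together span a submodule of a Noetherian module, so finitely many of them
    already span it. No determinant is involved, which suits a noncommutative [E]. *)
Lemma integral_at (z : E) : exists n (c : nat -> R), z ^+ n = \sum_(i < n) phi (c i) * z ^+ i.
Proof.
pose V := Defs.restrict phi (E^c)^o.
pose U k : set V := [set x : E | exists c : nat -> R, x = \sum_(i < k) phi (c i) * z ^+ i].
have sU k : submodule (U k).
  split; first by exists (fun=> 0); rewrite big1 // => i _; rewrite rmorph0 mul0r.
    move=> _ _ [c ->] [d ->]; exists (fun i => c i + d i).
    by rewrite -big_split; apply: eq_bigr => i _; rewrite rmorphD mulrDl.
  move=> r _ [c ->]; exists (fun i => r * c i); rewrite restrict_regularZ mulr_sumr.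
  by apply: eq_bigr => i _; rewrite mulrA rmorphM.
have U_mono k l : (k <= l)%N -> U k `<=` U l.
  move=> /subnK <- _ [c ->]; exists (fun i => if (i < k)%N then c i else 0).
  rewrite addnC big_split_ord /= [X in _ + X]big1 ?addr0 => [|i _].
    by apply: eq_bigr => i _; rewrite ltn_ord.
  by rewrite ltnNge leq_addr rmorph0 mul0r.
have sbU : submodule (\bigcup_k U k).
  split; first by exists 0%N => //; case: (sU 0%N).
    move=> x y [i _ Ux] [j _ Uy]; exists (maxn i j) => //.
    have [_ UD _] := sU (maxn i j).
    by apply: UD; [apply: U_mono Ux | apply: U_mono Uy]; rewrite ?leq_maxl ?leq_maxr.
  by move=> r x [k _ Ux]; exists k => //; have [_ _ UZ] := sU k; apply: UZ.
have [l lT] := (lspanT_finitely_generated V).1 E_finite.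
have [|l' l'P] := @noetherian_submodule R V l _ noethR sbU; first by rewrite lT.
have [k kP] : exists k, forall x, x \in l' -> U k x.
  have : forall x, x \in l' -> (\bigcup_k U k) x by rewrite -l'P => x /lspan_mem.
  elim: {l'P} l' => [|y l' IH] l'U; first by exists 0%N.
  have [|k kP] := IH; first by move=> x lx; apply: l'U; rewrite inE lx orbT.
  have [j _ Uy] := l'U y (mem_head _ _).
  exists (maxn j k) => x; rewrite inE => /orP[/eqP ->|/kP Ux].
    by apply: U_mono Uy; rewrite leq_maxl.
  by apply: U_mono Ux; rewrite leq_maxr.
have : (\bigcup_k U k) (z ^+ k).
  exists k.+1 => //; exists (fun i => (i == k)%:R).
  rewrite big_ord_recr /= eqxx rmorph1 mul1r big1 ?add0r // => i _.
  by rewrite (ltn_eqF (ltn_ord i)) rmorph0 mul0r.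
by rewrite -l'P => /(lspan_sub (sU k) kP)[c zE]; exists k, c.
Qed.

Variable p : spec R.

Lemma specM r s : ~ (p : set R) r -> ~ (p : set R) s -> ~ (p : set R) (r * s).
Proof. by have [_ _ pM] := specP p; move=> nr ns /pM[]. Qed.

Lemma specX r n : ~ (p : set R) r -> ~ (p : set R) (r ^+ n).
Proof.
move=> nr; elim: n => [|n IH]; first by rewrite expr0; case: (specP p).
by rewrite exprS; apply: specM.
Qed.

(** Invertibility in the localization at [p], with the denominators cleared. *)
Definition unit_at (x : E) : Prop :=
  exists y s, [/\ ~ (p : set R) s, y * x = phi s & x * y = phi s].

(** [Z = phi r * z] is a root of a monic polynomial F whose lower coefficients lie in [p]. As [s] is
    central, F(-s) = F(-s) - F(Z) is divisible by -s - Z on both sides, and F(-s) is congruent to a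
    power of -s modulo [p]. *)
Lemma nakayama_unit s r (z : E) : ~ (p : set R) s -> (p : set R) r ->
  unit_at (phi s + phi r * z).
Proof.
move=> nps pr; have [[p0 pD pM] p1 _] := specP p.
have [n [c zn]] := integral_at z.
pose Z := phi r * z.
pose d i := c i * r ^+ (n - i).
have Zn : Z ^+ n = \sum_(i < n) phi (d i) * Z ^+ i.
  have rz k : Z ^+ k = phi (r ^+ k) * z ^+ k.
    by rewrite /Z exprMn_comm ?rmorphXn //; apply/esym/phiC.
  rewrite rz zn mulr_sumr; apply: eq_bigr => i _.
  rewrite rz !mulrA -!rmorphM /d -mulrA -exprD subnK; last exact/ltnW.
  by rewrite mulrC.
have pd (i : 'I_n) : (p : set R) (d i).
  rewrite /d; have -> : (n - i = (n - i).-1.+1)%N by have := ltn_ord i; lia.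
  by rewrite exprSr mulrA; apply: pM.
have quo k : exists g : E, phi ((- s) ^+ k) - Z ^+ k = (phi (- s) - Z) * g /\
    phi ((- s) ^+ k) - Z ^+ k = g * (phi (- s) - Z).
  elim: k => [|k [g [g1 g2]]].
    by exists 0; rewrite !expr0 rmorph1 subrr mulr0 mul0r.
  set D := phi (- s) - Z in g1 g2 *.
  have DZ : D * Z = Z * D by rewrite /D mulrBl mulrBr phiC.
  exists (phi ((- s) ^+ k) + Z * g).
  have E0 : phi ((- s) ^+ k.+1) - Z ^+ k.+1 =
      D * phi ((- s) ^+ k) + Z * (phi ((- s) ^+ k) - Z ^+ k).
    by rewrite !exprS rmorphM /D mulrBl mulrBr addrA subrK.
  split.
    by rewrite E0 g1 mulrDr (mulrA Z) (mulrA D Z) DZ.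
  by rewrite E0 g2 [RHS]mulrDl (mulrA Z) phiC.
have /choice[g gP] := quo.
pose D := (- s) ^+ n - \sum_(i < n) d i * (- s) ^+ i.
have nD : ~ (p : set R) D.
  move=> pD0; suff : (p : set R) (s ^+ n) by apply: specX.
  have : (p : set R) ((- s) ^+ n).
    rewrite -[_ ^+ n](subrK (\sum_(i < n) d i * (- s) ^+ i)); apply: (pD) => //.
    by apply: big_ind => // i _; rewrite mulrC; apply: pM.
  by rewrite exprNn => /(pM ((-1) ^+ n)); rewrite mulrA -expr2 sqrr_sign mul1r.
exists (- (g n - \sum_(i < n) phi (d i) * g i)), D.
have DE : phi D = (phi ((- s) ^+ n) - Z ^+ n) -
    \sum_(i < n) phi (d i) * (phi ((- s) ^+ i) - Z ^+ i).
  under eq_bigr => i _ do rewrite mulrBr.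
  rewrite sumrB -Zn /D rmorphB rmorph_sum /= opprB addrACA addrA.
  under eq_bigr => i _ do rewrite rmorphM.
  by rewrite addrAC -!addrA; congr (_ + _); rewrite addrC subrK.
have sZ : phi s + Z = - (phi (- s) - Z) by rewrite rmorphN opprB opprK addrC.
rewrite -/Z sZ mulrNN mulrNN; split=> //.
  rewrite DE (gP n).2 mulrBl mulr_suml; congr (_ - _).
  by apply: eq_bigr => i _; rewrite (gP i).2 mulrA.
rewrite DE (gP n).1 mulrBr mulr_sumr; congr (_ - _).
by apply: eq_bigr => i _; rewrite (gP i).1 !mulrA phiC.
Qed.

Let B := loc_alg phi p.
Let A := jac_quot B.
Let psi (x : E) : A := jac_proj (afrac phi x (denom1 p) : B).
Let theta (r : R) : A := psi (phi r).

Let psiM x y : psi (x * y) = psi x * psi y.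
Proof.
rewrite /psi -jac_projM afracM; congr jac_proj; apply: afrac_eq_sim.
by rewrite /= mulr1.
Qed.

Let psiD x y : psi (x + y) = psi x + psi y.
Proof.
rewrite /psi -jac_projD afracD; congr jac_proj; apply: afrac_eq_sim.
by rewrite /= mulr1 !rmorph1 !mul1r.
Qed.

Let psi0 : psi 0 = 0. Proof. by apply: (addIr (psi 0)); rewrite -psiD !add0r. Qed.

Let theta_zmod_morphism : zmod_morphism theta.
Proof.
move=> r s; rewrite /theta rmorphB; apply: (addIr (psi (phi s))).
by rewrite -psiD !subrK.
Qed.

Let theta_monoid_morphism : monoid_morphism theta.
Proof.
by split=> [|r s]; rewrite /theta ?rmorph1 // rmorphM psiM.
Qed.

HB.instance Definition _ := GRing.isZmodMorphism.Build R A theta theta_zmod_morphism.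
HB.instance Definition _ := GRing.isMonoidMorphism.Build R A theta theta_monoid_morphism.

Let theta_afrac s x (u : denom p) : dval u = s ->
  theta s * jac_proj (afrac phi x u : B) = psi x.
Proof.
move=> <-; rewrite /theta /psi -jac_projM afracM; congr jac_proj.
by apply: afrac_eq_sim; rewrite /= rmorphM rmorph1 !mul1r.
Qed.

Let theta_central r a : theta r * a = a * theta r.
Proof.
have [b ->] := jac_proj_surj a; have [x [u ->]] := afracP (b : B).
rewrite /theta /psi -!jac_projM !afracM; congr jac_proj; apply: afrac_eq_sim.
by rewrite /= mulrC phiC.
Qed.

Let theta_unit s : ~ (p : set R) s -> exists u, theta s * u = 1.
Proof.
move=> ns; exists (jac_proj (afrac phi 1 (Denom ns) : B)).
by rewrite theta_afrac.
Qed.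

(** The prime acts as zero modulo the radical, so every value of [theta] is 0 or a unit, as the
    count of leading indices requires. *)
Let theta_zero r : (p : set R) r -> theta r = 0.
Proof.
move=> pr; apply/jac_proj0 => b; have [z [u ->]] := afracP (b : B).
have [v [t [nt vP _]]] := nakayama_unit z (@denomP _ _ u) pr.
exists (afrac phi (v * phi (dval u)) (Denom nt)).
have -> : 1 + afrac phi z u * afrac phi (phi r) (denom1 p) =
    afrac phi (phi (dval u) + phi r * z) u.
  rewrite (afracM phi) [1]/(afrac phi 1 (denom1 p)) afracD; apply: afrac_eq_sim.
  by rewrite /= !mulr1 !mul1r rmorph1 mul1r phiC.
rewrite phiC afracM -mulrA vP; apply: afrac_eq_sim.
by rewrite /= mulr1 rmorph1 mul1r -rmorphM mulrC.
Qed.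

Let psi_dense b : exists s v, [/\ forall t, s * t = t * s, s * v = 1 &
  (exists x, s * b = psi x)].
Proof.
have [c ->] := jac_proj_surj b; have [x [u ->]] := afracP (c : B).
have [v uv] := theta_unit (@denomP _ _ u).
exists (theta (dval u)), v; split=> //.
by exists x; rewrite theta_afrac.
Qed.

Theorem unit_completion_at (alpha eta a : E) :
  (exists x y s, ~ (p : set R) s /\ alpha * x + eta * y = phi s) ->
  (exists z w s, ~ (p : set R) s /\ z * alpha + w * a = phi s) ->
  exists c, unit_at (alpha + eta * c * a).
Proof.
move=> [x [y [s [ns right_uni]]]] [z [w [t [nt left_uni]]]].
have [n [e eP]] := module_finite_generators.
have field r : theta r = 0 \/ exists u, theta r * u = 1.
  have [pr|npr] := pselect ((p : set R) r); [left|right].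
    exact: theta_zero.
  exact: theta_unit.
have spanning a0 : exists s (r : nat -> R), (exists u, theta s * u = 1) /\
    theta s * a0 = \sum_(i < n) theta (r i) * psi (e i).
  have [b ->] := jac_proj_surj a0; have [x0 [u ->]] := afracP (b : B).
  have [r xE] := eP x0; exists (dval u), r; split.
    exact/theta_unit/denomP.
  rewrite theta_afrac // xE (big_morph psi psiD psi0).
  by apply: eq_bigr => i _; exact: psiM.
(* Taking the witness from the image of [E] itself, not of its localization, makes [c] a global
   element. *)
pose C : set A := range psi.
have [s' ss'] := theta_unit ns; have [t' tt'] := theta_unit nt.
have [||||| c' [u [[c _ <-] uc cu]]] := @unit_completion A (@jac_quot_semiprime B)
  (leading_count theta n (psi \o e)) n
  (@leading_count_bounded _ _ _ n (psi \o e))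
  (@leading_count_strict _ _ theta theta_central field n (psi \o e) spanning)
  C (psi alpha) (psi eta) (psi a) (psi x * s') (psi y * s') (t' * psi z) (t' * psi w).
- by exists 0 => //; exact: psi0.
- by move=> _ _ [b _ <-] [c _ <-]; exists (b + c); rewrite ?psiD.
- move=> b; have [q [v [qC qv [x0 qb]]]] := psi_dense b.
  by exists q, v; split=> //; exists x0.
- by rewrite !mulrA -mulrDl -!psiM -psiD right_uni.
- by rewrite -!mulrA -mulrDr -!psiM -psiD left_uni -[psi _]/(theta t) -theta_central.
exists c; move: uc cu; rewrite -!psiM -psiD => uc cu.
have [v [vl vr]] := jac_proj_lift_unit uc cu.
have [b [q vE]] := afracP (v : B); rewrite {v}vE in vl vr.
move: vl; rewrite (afracM phi) => /afrac_eqP[w1]; rewrite rmorph1 mul1r mulr1 => e1.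
move: vr; rewrite (afracM phi) => /afrac_eqP[w2]; rewrite rmorph1 mul1r mulr1 => e2.
set g := alpha + eta * c * a in e1 e2 *.
pose d1 := dval w1; pose d2 := dval w2.
exists (phi (d1 * d2) * b), (d1 * d2 * dval q); split.
- by apply: specM; [apply: specM|]; exact: denomP.
- rewrite -mulrA (mulrC d1) (rmorphM phi d2 d1) -mulrA e1 /= -!rmorphM mulr1.
  by congr (phi _); rewrite /d1 /d2; ring.
- rewrite mulrA phiC -mulrA (rmorphM phi d1 d2) -mulrA e2 /= -!rmorphM mul1r.
  by congr (phi _); rewrite /d1 /d2; ring.
Qed.

End ModuleFiniteAlgebra.

(** * Homomorphisms of right modules *)

Section Morphisms.
Variable T : pzRingType.

Record mor (A B : lmodType T) := Mor { mor_fun :> A -> B; morP : linear mor_fun }.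

HB.instance Definition _ (A B : lmodType T) := gen_eqMixin (mor A B).
HB.instance Definition _ (A B : lmodType T) := gen_choiceMixin (mor A B).
HB.instance Definition _ (A B : lmodType T) (f : mor A B) :=
  GRing.isLinear.Build T A B *:%R (mor_fun f) (morP f).

Lemma mor_ext (A B : lmodType T) (f g : mor A B) : f =1 g -> f = g.
Proof.
case: f g => [f fP] [g gP] /= /funext fg; rewrite fg in fP *.
by congr Mor; apply: Prop_irrelevance.
Qed.

Lemma mor_linearD (A B : lmodType T) (f : mor A B) x y : f (x + y) = f x + f y.
Proof. exact: linearD. Qed.
Lemma mor_linearB (A B : lmodType T) (f : mor A B) x y : f (x - y) = f x - f y.
Proof. exact: linearB. Qed.
Lemma mor_linearN (A B : lmodType T) (f : mor A B) x : f (- x) = - f x.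
Proof. exact: linearN. Qed.
Lemma mor_linear0 (A B : lmodType T) (f : mor A B) : f 0 = 0.
Proof. exact: linear0. Qed.

Lemma mor_linear_sum (A B : lmodType T) (f : mor A B) n (x : 'I_n -> A) :
  f (\sum_(i < n) x i) = \sum_(i < n) f (x i).
Proof. exact: linear_sum. Qed.

Definition mor_of (A B : lmodType T) (f : {linear A -> B}) : mor A B :=
  Mor (linearP f).

Definition mor_id (A : lmodType T) : mor A A := mor_of (idfun : {linear A -> A}).

Definition mor_comp (A B C : lmodType T) (f : mor B C) (g : mor A B) : mor A C :=
  mor_of (f \o g : {linear A -> C}).

Lemma mor_compE (A B C : lmodType T) (f : mor B C) (g : mor A B) x : mor_comp f g x = f (g x).
Proof. by []. Qed.

Lemma mor_idE (A : lmodType T) (x : A) : mor_id A x = x. Proof. by []. Qed.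

Section Zmodule.
Variables A B : lmodType T.
Implicit Types f g h : mor A B.

Definition mor_zero : mor A B := mor_of (\0 : {linear A -> B}).
Definition mor_add f g : mor A B := mor_of (f \+ g : {linear A -> B}).

Let mor_opp_linear f : linear (fun x => - f x).
Proof. by move=> a x y; rewrite linearP opprD scalerN. Qed.
Definition mor_opp f : mor A B := Mor (mor_opp_linear f).

Let mor_addA : associative mor_add.
Proof. by move=> f g h; apply: mor_ext => x /=; rewrite addrA. Qed.
Let mor_addC : commutative mor_add.
Proof. by move=> f g; apply: mor_ext => x /=; rewrite addrC. Qed.
Let mor_add0 : left_id mor_zero mor_add.
Proof. by move=> f; apply: mor_ext => x /=; rewrite add0r. Qed.
Let mor_addN : left_inverse mor_zero mor_opp mor_add.
Proof. by move=> f; apply: mor_ext => x /=; rewrite addNr. Qed.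

HB.instance Definition _ :=
  GRing.isZmodule.Build (mor A B) mor_addA mor_addC mor_add0 mor_addN.

Lemma morDE f g x : (f + g) x = f x + g x. Proof. by []. Qed.
Lemma morNE f x : (- f) x = - f x. Proof. by []. Qed.
Lemma mor0E x : (0 : mor A B) x = 0. Proof. by []. Qed.
Lemma mor_sumE n (f : 'I_n -> mor A B) x : (\sum_(i < n) f i) x = \sum_(i < n) f i x.
Proof. exact: (big_morph (fun f : mor A B => f x)). Qed.

End Zmodule.

Definition endo (A : lmodType T) : Type := mor A A.
HB.instance Definition _ (A : lmodType T) := GRing.Zmodule.on (endo A).

Section Endo.
Variable A : lmodType T.
Implicit Types f g h : endo A.

Let endo_mul f g : endo A := mor_comp f g.
Let endo_mulA : associative endo_mul.
Proof. by move=> f g h; apply: mor_ext. Qed.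
Let endo_mul1l : left_id (mor_id A : endo A) endo_mul.
Proof. by move=> f; apply: mor_ext. Qed.
Let endo_mul1r : right_id (mor_id A : endo A) endo_mul.
Proof. by move=> f; apply: mor_ext. Qed.
Let endo_mulDl : left_distributive endo_mul +%R.
Proof. by move=> f g h; apply: mor_ext. Qed.
Let endo_mulDr : right_distributive endo_mul +%R.
Proof. by move=> f g h; apply: mor_ext => x /=; rewrite linearD. Qed.

HB.instance Definition _ := GRing.Zmodule_isPzRing.Build (endo A)
  endo_mulA endo_mul1l endo_mul1r endo_mulDl endo_mulDr.

Lemma endoME f g x : (f * g) x = f (g x). Proof. by []. Qed.
Lemma endo1E x : (1 : endo A) x = x. Proof. by []. Qed.

End Endo.
End Morphisms.

Section RightModules.
Variables (R : comPzRingType) (S : pzRingType) (phi : algebra_on R S).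

Definition rscale (A : lmodType S^c) (r : R) (x : A) : A := (phi r : S^c) *: x.

Section Rscale.
Variables A B : lmodType S^c.
Implicit Types (x y : A) (r s : R).

Lemma rscaleA r s x : rscale r (rscale s x) = rscale (r * s) x.
Proof. exact: (@scalerA R (Defs.restrict phi A) r s x). Qed.
Lemma rscale1 x : rscale 1 x = x.
Proof. exact: (@scale1r R (Defs.restrict phi A) x). Qed.
Lemma rscaleDr r x y : rscale r (x + y) = rscale r x + rscale r y.
Proof. exact: scalerDr. Qed.
Lemma rscaleDl r s x : rscale (r + s) x = rscale r x + rscale s x.
Proof. exact: (@scalerDl R (Defs.restrict phi A) x r s). Qed.
Lemma rscaleB r x y : rscale r (x - y) = rscale r x - rscale r y.
Proof. exact: scalerBr. Qed.
Lemma rscale0 r : rscale r (0 : A) = 0.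
Proof. exact: scaler0. Qed.
Lemma rscale0l x : rscale 0 x = 0.
Proof. exact: (@scale0r R (Defs.restrict phi A) x). Qed.
Lemma rscaleNl r x : rscale (- r) x = - rscale r x.
Proof. exact: (@scaleNr R (Defs.restrict phi A) r x). Qed.
Lemma rscaleC r s x : rscale r (rscale s x) = rscale s (rscale r x).
Proof. by rewrite !rscaleA mulrC. Qed.
Lemma rscale_sumr r n (f : 'I_n -> A) :
  rscale r (\sum_(i < n) f i) = \sum_(i < n) rscale r (f i).
Proof. exact: scaler_sumr. Qed.
Lemma rscaleZ r (s : S^c) x : rscale r (s *: x) = s *: rscale r x.
Proof.
rewrite /rscale !scalerA.
exact: (congr1 (fun z : S^c => z *: x) (esym (alg_map_central phi r s))).
Qed.
Lemma mor_rscale (f : mor A B) r x : f (rscale r x) = rscale r (f x).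
Proof. exact: linearZ. Qed.

End Rscale.

Lemma rscale_ffun n (A : lmodType S^c) r (x : copies n A) i :
  (rscale r x) i = rscale r (x i).
Proof. by rewrite ffunE. Qed.

Section HomModule.
Variables A B : lmodType S^c.

Definition rhom : Type := mor A B.
HB.instance Definition _ := GRing.Zmodule.on rhom.

Let mor_scale_linear r (f : mor A B) : linear (fun x => rscale r (f x)).
Proof. by move=> a x y; rewrite linearP rscaleDr rscaleZ. Qed.
Definition mor_scale r (f : mor A B) : mor A B := Mor (mor_scale_linear r f).

Lemma mor_scaleE r f x : mor_scale r f x = rscale r (f x). Proof. by []. Qed.

Let mor_scaleA r s (f : rhom) : mor_scale r (mor_scale s f) = mor_scale (r * s) f.
Proof. by apply: mor_ext => x /=; rewrite rscaleA. Qed.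
Let mor_scale1 : left_id 1 (mor_scale : R -> rhom -> rhom).
Proof. by move=> f; apply: mor_ext => x /=; rewrite rscale1. Qed.
Let mor_scaleDr : right_distributive (mor_scale : R -> rhom -> rhom) +%R.
Proof. by move=> r f g; apply: mor_ext => x /=; rewrite rscaleDr. Qed.
Let mor_scaleDl (f : rhom) : {morph (fun r => mor_scale r f : rhom) : r s / r + s}.
Proof. by move=> r s; apply: mor_ext => x /=; rewrite rscaleDl. Qed.

HB.instance Definition _ := GRing.Zmodule_isLmodule.Build R rhom
  mor_scaleA mor_scale1 mor_scaleDr mor_scaleDl.

End HomModule.

Hypothesis noethR : noetherian R.
Hypothesis S_finite : module_finite phi.

Lemma finitely_generated_restrict (A : lmodType S^c) :
  finitely_generated A -> finitely_generated (Defs.restrict phi A).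
Proof.
move=> [n [g gP]]; have [m [e eP]] := module_finite_generators S_finite.
apply/lspanT_finitely_generated.
pose l : seq (Defs.restrict phi A) :=
  [seq (e i : S^c) *: g j | i <- iota 0 m, j <- enum 'I_n].
exists l; apply/seteqP; split=> // x _.
have sl := lspan_submodule l; have [_ _ lZ] := sl.
have [c ->] := gP x; apply: (submodule_sum sl) => j.
have [r cE] := eP (c j : S).
have -> : c j *: g j = \sum_(i < m) rscale (r i) ((e i : S^c) *: g j).
  rewrite cE scaler_suml; apply: eq_bigr => i _.
  by rewrite /rscale scalerA alg_map_central.
apply: (submodule_sum sl) => i; apply: lZ; apply: lspan_mem.
by apply/allpairsP; exists (val i, j); rewrite mem_iota mem_enum /= ltn_ord.
Qed.

(** Evaluation at the generators of [A] embeds the homomorphisms in a finite power of [B], which is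
    a Noetherian [R]-module. *)
Lemma rhom_finitely_generated (A B : lmodType S^c) :
  finitely_generated A -> finitely_generated B -> finitely_generated (rhom A B).
Proof.
move=> [n [g gP]] /finitely_generated_restrict B_fg.
pose ev (f : rhom A B) : {ffun 'I_n -> Defs.restrict phi B} := [ffun i => f (g i)].
have ev_linear : linear ev.
  by move=> r f h; apply/ffunP => i; rewrite !ffunE.
pose evL := GRing.isLinear.Build R (rhom A B) _ *:%R ev ev_linear.
pose ev' : {linear rhom A B -> {ffun 'I_n -> Defs.restrict phi B}} := HB.pack ev evL.
apply: (@finitely_generated_inj R _ _ ev' noethR).
  exact: finitely_generated_ffun.
move=> f h /ffunP fh; apply: mor_ext => x; have [c ->] := gP x.
rewrite !linear_sum; apply: eq_bigr => i _; rewrite !linearZ.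
by congr (_ *: _); move: (fh i); rewrite [LHS]ffunE [RHS]ffunE.
Qed.

Section EndoAlgebra.
Variable A : lmodType S^c.

Definition endo_alg_map (r : R) : endo A := mor_scale r (mor_id A).

Let endo_alg_zmod : zmod_morphism endo_alg_map.
Proof.
move=> r s; apply: mor_ext => x /=.
by rewrite rscaleDl rscaleNl.
Qed.

Let endo_alg_monoid : monoid_morphism endo_alg_map.
Proof.
split=> [|r s]; apply: mor_ext => x /=; first exact: rscale1.
by rewrite rscaleA.
Qed.

HB.instance Definition _ := GRing.isZmodMorphism.Build R (endo A) endo_alg_map endo_alg_zmod.
HB.instance Definition _ := GRing.isMonoidMorphism.Build R (endo A) endo_alg_map endo_alg_monoid.

Let endo_alg_central r (f : endo A) : endo_alg_map r * f = f * endo_alg_map r.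
Proof. by apply: mor_ext => x; rewrite !endoME /= mor_rscale. Qed.

Definition endo_alg : algebra_on R (endo A) := @AlgebraOn R (endo A) endo_alg_map endo_alg_central.


Lemma endo_module_finite : finitely_generated A -> module_finite endo_alg.
Proof.
move=> A_fg; have [n [g gP]] := rhom_finitely_generated A_fg A_fg.
exists n, g => f; have [c fE] := gP f; exists c.
rewrite [LHS]fE; apply: eq_bigr => i _.
apply: mor_ext => x.
exact: (esym (mor_rscale (g i) (c i) x)).
Qed.

End EndoAlgebra.
End RightModules.

(** * Local splittings *)

Section Copies.
Variables (T : pzRingType) (A B C : lmodType T).

Let component_linear n (i : 'I_n) : linear (fun x : copies n A => x i).
Proof. by move=> a x y; rewrite !ffunE. Qed.
Definition component n (i : 'I_n) : mor (copies n A) A := Mor (component_linear i).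

Let row_linear n (f : 'I_n -> mor B A) : linear (fun x => [ffun i => f i x] : copies n A).
Proof. by move=> a x y; apply/ffunP => i; rewrite !ffunE linearP. Qed.
Definition row_hom n (f : 'I_n -> mor B A) : mor B (copies n A) := Mor (row_linear f).

Lemma row_homE n (f : 'I_n -> mor B A) x i : row_hom f x i = f i x.
Proof. by rewrite ffunE. Qed.

Let pair_linear (f : mor A C) (g : mor B C) : linear (fun x : A * B => f x.1 + g x.2).
Proof. by move=> a x y /=; rewrite !linearP scalerDr addrACA. Qed.
Definition pair_hom (f : mor A C) (g : mor B C) : mor (A * B)%type C := Mor (pair_linear f g).

Let prod_linear (f : mor C A) (g : mor C B) : linear (fun x => (f x, g x) : A * B).
Proof. by move=> a x y /=; rewrite !linearP. Qed.
Definition prod_hom (f : mor C A) (g : mor C B) : mor C (A * B)%type := Mor (prod_linear f g).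

Definition fst_hom : mor (A * B)%type A := mor_of (fst : {linear (A * B)%type -> A}).
Definition snd_hom : mor (A * B)%type B := mor_of (snd : {linear (A * B)%type -> B}).

Lemma componentE n (i : 'I_n) x : component i x = x i. Proof. by []. Qed.
Lemma pair_homE (f : mor A C) (g : mor B C) x : pair_hom f g x = f x.1 + g x.2.
Proof. by []. Qed.
Lemma prod_homE (f : mor C A) (g : mor C B) x : prod_hom f g x = (f x, g x).
Proof. by []. Qed.
Lemma fst_homE x : fst_hom x = x.1. Proof. by []. Qed.
Lemma snd_homE x : snd_hom x = x.2. Proof. by []. Qed.

End Copies.

Section Injections.
Variables (T : pzRingType) (A : lmodType T).
Definition inject n (i : 'I_n) : mor A (copies n A) :=
  row_hom (fun j => if j == i then mor_id A else 0).

Lemma injectE n (i j : 'I_n) x : inject i x j = if j == i then x else 0.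
Proof. by rewrite row_homE; case: eqP. Qed.

End Injections.

Definition morE := (mor_compE, fst_homE, snd_homE, pair_homE, prod_homE, componentE,
  @morDE, @morNE, @mor0E, mor_scaleE).

Section Splitting.
Variables (R : comPzRingType) (S : pzRingType) (phi : algebra_on R S).
Hypothesis noethR : noetherian R.
Hypothesis S_finite : module_finite phi.
Variables N P : lmodType S^c.
Hypothesis N_fg : finitely_generated N.
Local Notation rs := (rscale phi).

Lemma unit_completion_endo (p : spec R) (Q : lmodType S^c) (alpha eta a : endo Q) :
  finitely_generated Q ->
  (exists (x y : endo Q) s, ~ (p : set R) s /\ forall v, alpha (x v) + eta (y v) = rs s v) ->
  (exists (z w : endo Q) s, ~ (p : set R) s /\ forall v, z (alpha v) + w (a v) = rs s v) ->
  exists (c u : endo Q) s, [/\ ~ (p : set R) s,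
    forall v, u (alpha v + eta (c (a v))) = rs s v &
    forall v, alpha (u v) + eta (c (a (u v))) = rs s v].
Proof.
move=> Q_fg [x [y [s [ns right_uni]]]] [z [w [t [nt left_uni]]]].
have e1 : alpha * x + eta * y = endo_alg phi Q s by apply: mor_ext => v; exact: right_uni.
have e2 : z * alpha + w * a = endo_alg phi Q t by apply: mor_ext => v; exact: left_uni.
have [||c [u [q [nq uc cu]]]] := @unit_completion_at _ _ _ noethR
    (endo_module_finite noethR S_finite Q_fg) p alpha eta a.
- by exists x, y, s.
- by exists z, w, t.
exists c, u, q; split=> // v.
  by have := congr1 (fun f : endo Q => f v) uc.
by have := congr1 (fun f : endo Q => f v) cu.
Qed.

(** After localization at [p], [Psi] maps a copy of [N]^t isomorphically onto a direct summand of
    [P]. *)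
Definition splits_at (p : spec R) (t : nat) (F : lmodType S^c) (Psi : mor F P) : Prop :=
  exists (B : mor (copies t N) F) (A : mor P (copies t N)) s,
    ~ (p : set R) s /\ forall x, A (Psi (B x)) = rs s x.

Lemma splits_at_le p t t' F (Psi : mor F P) : (t' <= t)%N ->
  splits_at p t Psi -> splits_at p t' Psi.
Proof.
move=> le_t't [B [A [s [ns AB]]]].
pose cut : mor (copies t N) (copies t' N) :=
  row_hom (fun j => component N (widen_ord le_t't j)).
pose pad : mor (copies t' N) (copies t N) :=
  row_hom (fun i => if insub (val i) is Some j then component N j else 0).
exists (mor_comp B pad), (mor_comp cut A), s; split=> // x.
rewrite !morE AB; apply/ffunP => j.
by rewrite row_homE componentE !rscale_ffun row_homE /= valK.
Qed.

Lemma splits_at0 p F (Psi : mor F P) : splits_at p 0 Psi.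
Proof.
exists 0, 0, 1; split; first by case: (specP p).
by move=> x; apply/ffunP => -[].
Qed.

(** A shear replaces [h] by [h] + [Psi] c' so that the first coordinate of its composite with [A]
    becomes a local unit. Dividing the t + 1 copies by this column removes one copy, and the others
    are split through [Psi] alone. *)
Lemma splits_at_drop p t F (Psi : mor F P) (h : mor N P) :
  splits_at p t.+1 (pair_hom Psi h) -> splits_at p t Psi.
Proof.
move=> [B [A [s [ns AB]]]].
pose B' := mor_comp (fst_hom F N) B; pose b := mor_comp (snd_hom F N) B.
have {}AB x : A (Psi (B' x)) + A (h (b x)) = rs s x by rewrite -AB !morE mor_linearD.
pose i0 : mor N (copies t.+1 N) := inject N ord0.
pose p0 : mor (copies t.+1 N) N := component N ord0.
pose q1 : endo N := mor_comp p0 (mor_comp A h).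
pose x1 : endo N := mor_comp p0 (mor_comp A (mor_comp Psi (mor_comp B' i0))).
(* The first diagonal entry of [AB] is the relation [q1] ([b] [i0]) + [x1] = [s], so [q1] + [x1] [y]
   is a local unit for some [y]. *)
have [||y [v' [s1 [ns1 vl vr]]]] := @unit_completion_endo p N q1 x1 1 N_fg.
- exists (mor_comp b i0), 1, s; split=> // v.
  have := congr1 (fun z : copies t.+1 N => z ord0) (AB (i0 v)).
  rewrite ffunE rscale_ffun injectE eqxx => <-.
  by rewrite endo1E /q1 /x1 !morE addrC.
- exists 0, 1, 1; split; first by case: (specP p).
  by move=> v; rewrite mor0E add0r !endo1E rscale1.
pose c' : mor N F := mor_comp B' (mor_comp i0 y).
pose Qc : mor N (copies t.+1 N) := mor_comp A (h + mor_comp Psi c').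
have Qc0 v : Qc v ord0 = q1 v + x1 (y v).
  by rewrite /Qc /c' /q1 /x1 !morE mor_linearD ffunE.
(* [W] kills the column [Qc], and on vectors with first coordinate 0 it is [s1] times the projection
   to the other coordinates. *)
pose W : mor (copies t.+1 N) (copies t N) := row_hom (fun i =>
  mor_scale phi s1 (component N (lift ord0 i)) -
  mor_comp (component N (lift ord0 i)) (mor_comp Qc (mor_comp v' p0))).
have WE z i : W z i = rs s1 (z (lift ord0 i)) - Qc (v' (z ord0)) (lift ord0 i).
  by rewrite row_homE !morE.
have WQc v : W (Qc v) = 0.
  apply/ffunP => i; rewrite WE Qc0 (vl v : v' (q1 v + x1 (y v)) = rs s1 v).
  by rewrite mor_rscale rscale_ffun subrr ffunE.
pose rest : mor (copies t N) (copies t.+1 N) :=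
  row_hom (fun j => if unlift ord0 j is Some i then component N i else 0).
pose Z := mor_comp B' rest - mor_comp c' (mor_comp b rest).
exists Z, (mor_comp W A), (s * s1); split=> [|x]; first exact: specM.
have -> : mor_comp W A (Psi (Z x)) = W (rs s (rest x) - Qc (b (rest x))).
  rewrite -AB /Z /Qc !morE mor_linearB; congr (W _).
  by rewrite mor_linearB mor_linearD opprD addrA addrK.
rewrite mor_linearB WQc subr0 mor_rscale -rscaleA; congr (rs s _).
apply/ffunP => i; rewrite WE rscale_ffun !row_homE unlift_none liftK mor0E !mor_linear0.
by rewrite ffunE subr0.
Qed.

Lemma finitely_generated_copies n : finitely_generated (copies n N).
Proof. exact: finitely_generated_ffun. Qed.

Section Perturbation.
Variables (p : spec R) (r : nat).
Variables (Psi : mor (copies r.+1 N) P) (h : mor N P) (a : endo N).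
Let i0 : mor N (copies r.+1 N) := inject N ord0.

(** Makes the correction of the first entry pass through [a]: [perturb] adds [h] c_0 [a] to that
    entry and [h] c_i to the others. *)
Definition twist : endo (copies r.+1 N) :=
  row_hom (fun i => if i == ord0 then mor_comp a (component N i) else component N i).

Lemma twistE x i : twist x i = if i == ord0 then a (x i) else x i.
Proof. by rewrite row_homE; case: eqP. Qed.

Definition perturb (c : mor (copies r.+1 N) N) : mor (copies r.+1 N) P :=
  Psi + mor_comp h (mor_comp c twist).

(* The splitting [A] is first modified on one coordinate so that its composite
   with the first column of [Psi] stays jointly split with [a]. *)
Lemma splits_at_adapted t : splits_at p t.+1 (pair_hom Psi h) ->
  (exists (f : mor P N) (b : endo N) s, ~ (p : set R) s /\
     forall x, f (Psi (i0 x)) + b (a x) = rs s x) ->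
  exists (B : mor (copies t.+1 N) (copies r.+1 N * N)%type) (A : mor P (copies t.+1 N)) s
         (g : mor (copies t.+1 N) N) (b : endo N) s',
    [/\ ~ (p : set R) s, forall x, A (pair_hom Psi h (B x)) = rs s x, ~ (p : set R) s' &
        forall x, g (A (Psi (i0 x))) + b (a x) = rs s' x].
Proof.
move=> [B [A0 [s [ns A0B]]]] [f [b [s0 [ns0 fb]]]].
set Phi := pair_hom Psi h in A0B *.
have [k kE] : exists k : mor (copies t.+1 N) N, forall x, k x = f (Phi (B x)).
  by exists (mor_comp f (mor_comp Phi B)).
(* [f2] vanishes on the image of [Phi] after [B], so any multiple of it can be added to [A0] without
   disturbing the splitting. *)
have [f2 f2E] : exists f2 : mor P N, forall x, f2 x = rs s (f x) - k (A0 x).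
  by exists (mor_scale phi s f - mor_comp k A0).
have f2B x : f2 (Phi (B x)) = 0 by rewrite f2E A0B mor_rscale kE subrr.
pose j0 : mor N (copies t.+1 N) := inject N ord0.
pose alpha : endo N := mor_comp (component N ord0) (mor_comp A0 (mor_comp Psi i0)).
have alphaE x : alpha x = A0 (Psi (i0 x)) ord0 by [].
(* [k'] ignores coordinate 0, the only one in which [A] will differ from [A0]. *)
have [k' k'E] : exists k' : mor (copies t.+1 N) N, forall x, k' x = k x - k (j0 (x ord0)).
  by exists (k - mor_comp k (mor_comp j0 (component N ord0))).
have [g gE] : exists g : endo N, forall x,
    g x = f2 (Psi (i0 x)) + k' (A0 (Psi (i0 x))) + rs s (b (a x)).
  by exists (mor_comp f2 (mor_comp Psi i0) +
    mor_comp k' (mor_comp A0 (mor_comp Psi i0)) + mor_scale phi s (mor_comp b a)).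
clearbody alpha.
have [||c [u [s2 [ns2 uc _]]]] := @unit_completion_endo p N alpha 1 g N_fg.
- exists 0, 1, 1; split; first by case: (specP p).
  by move=> v; rewrite mor0E mor_linear0 add0r !endo1E rscale1.
(* Multiplying the given relation by [s] and substituting [f2] + [k] [A0] for [s] times [f] turns it
   into [k] [j0] [alpha] + [g] = [s] [s0]. *)
- exists (mor_comp k j0), 1, (s * s0); split; first exact: specM.
  move=> x; rewrite endo1E mor_compE -rscaleA -fb rscaleDr gE k'E f2E alphaE addrA.
  by congr (_ + _); rewrite addrC subrKA subrK.
have {}uc v : u (alpha v + c (g v)) = rs s2 v := uc v.
pose A := A0 + mor_comp j0 (mor_comp c f2).
have AE x : A x = A0 x + j0 (c (f2 x)) by [].
have A_zero x : A x ord0 = A0 x ord0 + c (f2 x) by rewrite AE ffunE injectE eqxx.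
have k'A x : k' (A x) = k' (A0 x).
  rewrite !k'E A_zero AE !mor_linearD opprD addrACA -[RHS]addr0; congr (_ + _).
  by rewrite subrr.
clearbody A.
have [g1 g1E] : exists g1 : mor (copies t.+1 N) N, forall y,
    g1 y = u (y ord0) + u (c (k' y)).
  by exists (mor_comp u (component N ord0) + mor_comp u (mor_comp c k')).
exists B, A, s, g1, (mor_scale phi s (mor_comp u (mor_comp c b))), s2; split=> // x.
  by rewrite AE f2B !mor_linear0 addr0 A0B.
rewrite g1E A_zero k'A mor_scaleE !mor_compE -uc gE alphaE !mor_linearD !mor_rscale.
by rewrite !addrA.
Qed.

(** The stable range property concerns endomorphisms of one module, so the target of [A] is padded
    by zeros up to [F]; this is why [t] is at most the length of the list. The coordinates beyond
    the padding are supplied by [eta]. *)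
Lemma splits_at_perturb t : (t <= r.+1)%N -> splits_at p t (pair_hom Psi h) ->
  (exists (f : mor P N) (b : endo N) s, ~ (p : set R) s /\
     forall x, f (Psi (i0 x)) + b (a x) = rs s x) ->
  exists c, splits_at p t (perturb c).
Proof.
case: t => [|t] le_tr splitF adapted; first by exists 0; apply: splits_at0.
have [B [A [s [g [b [s2 [ns AB ns2 gA]]]]]]] := splits_at_adapted splitF adapted.
have {}AB x : A (Psi (B x).1) + A (h (B x).2) = rs s x.
  by rewrite -mor_linearD -AB.
pose F := copies r.+1 N.
have [cut cutE] : exists cut : mor F (copies t.+1 N),
    forall x j, cut x j = x (widen_ord le_tr j).
  exists (row_hom (fun j => component N (widen_ord le_tr j))) => x j.
  by rewrite row_homE.
have [pad padE] : exists pad : mor (copies t.+1 N) F,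
    forall x i, pad x i = if insub (val i) is Some j then x j else 0.
  exists (row_hom (fun i => if insub (val i) is Some j then component N j else 0)) => x i.
  by rewrite row_homE; case: insub.
have [tail tailE] : exists tail : mor F F,
    forall x i, tail x i = if (i < t.+1)%N then 0 else x i.
  exists (row_hom (fun i : 'I_r.+1 => if (i < t.+1)%N then 0 else component N i)) => x i.
  by rewrite row_homE; case: ifP.
have [rho rhoE] : exists rho : mor F F,
    forall x i, rho x i = if i == ord0 then 0 else x i.
  exists (row_hom (fun i : 'I_r.+1 => if i == ord0 then 0 else component N i)) => x i.
  by rewrite row_homE; case: ifP.
have cut_pad x : cut (pad x) = x by apply/ffunP => j; rewrite cutE padE valK.
have cut_tail x : cut (tail x) = 0.
  by apply/ffunP => j; rewrite cutE tailE /= ltn_ord ffunE.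
have pad_tail x : pad (cut x) + tail x = x.
  apply/ffunP => i; rewrite ffunE padE tailE; case: insubP => [j lt_it ji|/negPf ->].
    by rewrite lt_it addr0 cutE; congr (x _); apply: val_inj; rewrite /= ji.
  by rewrite add0r.
have tail_tail x : tail (tail x) = tail x.
  by apply/ffunP => i; rewrite !tailE; case: (i < t.+1)%N.
have tail0 x : tail x ord0 = 0 by rewrite tailE.
have tail_i0 x : tail (i0 x) = 0.
  apply/ffunP => i; rewrite tailE [RHS]ffunE /i0 injectE.
  by case: eqP => [->|_]; rewrite ?if_same.
have rho_twist (x : F) : x = i0 (x ord0) + rho (twist x).
  apply/ffunP => i; rewrite ffunE /i0 injectE rhoE twistE.
  by case: eqP => [->|]; rewrite ?addr0 ?add0r.
pose alpha : endo F := mor_comp pad (mor_comp A Psi).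
(* [eta] reads the coefficient of [h] off coordinate 0, where [tail] vanishes, so its two summands
   can be prescribed independently in [Y]. *)
pose eta : endo F := mor_comp pad (mor_comp A (mor_comp h (component N ord0))) + tail.
have alphaE x : alpha x = pad (A (Psi x)) by [].
have etaE x : eta x = pad (A (h (x ord0))) + tail x by [].
clearbody alpha eta.
have [||C [U [s3 [ns3 _ CU]]]] :=
  @unit_completion_endo p F alpha eta twist (finitely_generated_copies _).
- have [X XE] : exists X : endo F, forall y, X y = (B (cut y)).1.
    by exists (mor_comp (fst_hom F N) (mor_comp B cut)).
  have [Y YE] : exists Y : endo F, forall y, Y y = i0 (B (cut y)).2 + rs s (tail y).
    exists (mor_comp i0 (mor_comp (snd_hom F N) (mor_comp B cut)) +
      mor_scale phi s tail) => y.
    by [].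
  exists X, Y, s; split=> // y; rewrite alphaE etaE XE YE.
  rewrite mor_linearD tail_i0 add0r mor_rscale tail_tail ffunE rscale_ffun tail0.
  rewrite rscale0 addr0 /i0 injectE eqxx addrA -mor_linearD AB mor_rscale -rscaleDr.
  by rewrite pad_tail.
- have [z zE] : exists z : endo F, forall y, z y = i0 (g (cut y)).
    by exists (mor_comp i0 (mor_comp g cut)).
  (* By [rho_twist], everything about x except its first entry is recovered from [twist] x. So [w]
     can remove the other columns from [g] [A] [Psi] and rebuild the remaining coordinates. *)
  have [w wE] : exists w : endo F, forall y,
      w y = i0 (b (y ord0)) - i0 (g (A (Psi (rho y)))) + rs s2 (rho y).
    by exists (mor_comp i0 (mor_comp b (component N ord0)) -
      mor_comp i0 (mor_comp g (mor_comp A (mor_comp Psi rho))) + mor_scale phi s2 rho).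
  exists z, w, s2; split=> // x; rewrite zE wE alphaE cut_pad twistE eqxx.
  rewrite [in RHS](rho_twist x) rscaleDr addrA; congr (_ + _).
  have -> : g (A (Psi x)) = g (A (Psi (i0 (x ord0)))) + g (A (Psi (rho (twist x)))).
    by rewrite -!mor_linearD -rho_twist.
  by rewrite -mor_rscale -gA !mor_linearD addrACA subrr addr0.
(* [cut] discards [tail], so only the first coordinate of [C] remains as coefficient of [h]. *)
exists (mor_comp (component N ord0) C), (mor_comp U pad), A, s3; split=> // x.
have := congr1 cut (CU (pad x)).
rewrite alphaE etaE mor_rscale !mor_linearD !cut_pad cut_tail addr0 => <-.
by rewrite -mor_linearD.
Qed.

End Perturbation.
End Splitting.

(** * Reducing lists of homomorphisms *)

Lemma ltn_count (T : eqType) (a b : pred T) (l : seq T) (x : T) :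
  subpred a b -> x \in l -> b x -> ~~ a x -> (count a l < count b l)%N.
Proof.
move=> ab; elim: l => // y l IH; rewrite inE => /orP[/eqP <-|lx] bx nax /=.
  by rewrite bx (negPf nax) add0n add1n ltnS sub_count.
rewrite -addnS leq_add ?IH //.
by have := ab y; case: (a y) => // ->.
Qed.

Section BasicElements.
Variables (R : comPzRingType) (S : pzRingType) (phi : algebra_on R S).
Hypothesis noethR : noetherian R.
Hypothesis S_finite : module_finite phi.
Variables N P : lmodType S^c.
Hypothesis N_fg : finitely_generated N.
Local Notation rs := (rscale phi).
Local Notation splits_at := (splits_at phi N).
Local Notation i0 := (inject N ord0).

Lemma spec_ext (p q : spec R) : (p : set R) = q -> p = q.
Proof.
case: p q => [p pP] [q qP] /= pq; rewrite pq in pP *.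
by congr Spec; apply: Prop_irrelevance.
Qed.

Definition jointly_split r (Psi : mor (copies r.+1 N) P) (a : endo N) : Prop :=
  exists (f : mor P N) (b : endo N), forall x, f (Psi (i0 x)) + b (a x) = x.

Lemma twist_i0 r (a : endo N) x : twist r a (i0 x) = i0 (a x).
Proof.
by apply/ffunP => i; rewrite twistE !injectE; case: eqP => // _; rewrite mor_linear0.
Qed.

Lemma perturbE r (Psi : mor (copies r.+1 N) P) (h : mor N P) a c x :
  perturb Psi h a c x = Psi x + h (c (twist r a x)).
Proof. by []. Qed.

(** The first entry changes by a multiple of [a], which the coefficient [b] absorbs. *)
Lemma jointly_split_perturb r (Psi : mor (copies r.+1 N) P) (h : mor N P) a c :
  jointly_split Psi a -> jointly_split (perturb Psi h a c) a.
Proof.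
move=> [f [b fb]]; exists f, (b - mor_comp f (mor_comp h (mor_comp c i0))) => x.
by rewrite perturbE twist_i0 mor_linearD !morE addrA addrAC addrK.
Qed.

(* Nakayama: splitting at [p] is insensitive to a change by an element of [p]. *)
Lemma splits_at_congr (p : spec R) t F (Psi D : mor F P) x : (p : set R) x ->
  splits_at p t Psi -> splits_at p t (Psi + mor_scale phi x D).
Proof.
move=> px [B [A [s [ns AB]]]].
have N_fg' : finitely_generated (copies t N) by exact: finitely_generated_ffun.
have [y [s' [ns' yP _]]] := @nakayama_unit R _ (endo_alg phi (copies t N)) noethR
  (endo_module_finite noethR S_finite N_fg') p s x (mor_comp A (mor_comp D B)) ns px.
exists B, (mor_comp y A), s'; split=> // v.
have H : y (rs s v + rs x (A (D (B v)))) = rs s' v :=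
  congr1 (fun f : endo _ => f v) yP.
by rewrite -H mor_compE morDE mor_scaleE mor_linearD AB mor_rscale.
Qed.

(** The scalar [x] is a local unit at [p], but may lie in other primes, where the next correction
    should be invisible. *)
Lemma splits_at_shear (p : spec R) t r (Psi : mor (copies r.+1 N) P) (h : mor N P) a c x :
  ~ (p : set R) x -> splits_at p t (pair_hom Psi h) ->
  splits_at p t (pair_hom (perturb Psi h a c) (mor_scale phi x h)).
Proof.
move=> nx [B [A [s [ns AB]]]].
pose B1 := mor_comp (fst_hom _ _) B; pose B2 := mor_comp (snd_hom _ _) B.
pose c' := mor_comp c (mor_comp (twist r a : mor _ _) B1).
exists (prod_hom (mor_scale phi x B1) (B2 - c')), A, (x * s); split=> [|v].
  exact: specM.
rewrite -rscaleA -AB prod_homE !pair_homE perturbE !mor_scaleE !mor_rscale.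
rewrite -!mor_rscale; congr (mor_fun A _); rewrite !mor_rscale -!rscaleDr.
congr (rs x _); rewrite /c' !morE mor_linearB.
by rewrite -addrA subrKC.
Qed.

Lemma perturb_scale r (Psi : mor (copies r.+1 N) P) (h : mor N P) a c c' x :
  perturb (perturb Psi h a c) (mor_scale phi x h) a c' =
  perturb Psi h a (c + mor_scale phi x c').
Proof.
apply: mor_ext => v; rewrite !perturbE morDE !mor_scaleE mor_linearD mor_rscale.
by rewrite addrA.
Qed.

(* Treat the primes in an order in which none is contained in a later one: then
   each new perturbation can be taken in the earlier primes. *)
Lemma perturb_finitely_many r (Psi : mor (copies r.+1 N) P) (h : mor N P) a :
  jointly_split Psi a -> forall L : seq (spec R), uniq L ->
  exists c, forall p t, p \in L -> (t <= r.+1)%N ->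
    splits_at p t (pair_hom Psi h) -> splits_at p t (perturb Psi h a c).
Proof.
move=> joint L; move: {2}(size L) (erefl (size L)) => n.
elim: n L => [|n IH] L sL uL; first by exists 0 => p t; rewrite (size0nil sL).
pose below (p : spec R) := count (fun q : spec R => `[< q `<=` p >]) L.
have [|p pL minp] := @exists_minimizer _ (fun p => p \in L) below.
  by case: L sL {uL below} => // p L _; exists p; rewrite mem_head.
have {}minp q : q \in L -> (q : set R) `<=` p -> q = p.
  move=> qL qp; apply: contrapT => nqp; have := minp q qL; apply/negP; rewrite -ltnNge.
  have pq : ~ ((p : set R) `<=` q).
    by move=> pq; apply: nqp; apply: spec_ext; apply/seteqP.
  apply: (@ltn_count _ _ _ _ p) => //; last exact/asboolP.
    move=> q' /asboolP q'q; apply/asboolP; exact: subset_trans qp.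
  exact/asboolP.
have sL' : size (rem p L) = n by rewrite size_rem // sL.
have [c cP] := IH _ sL' (rem_uniq p uL).
have [x [xL nxp]] : exists x, (forall q, q \in rem p L -> (q : set R) x) /\ ~ (p : set R) x.
  have : forall q, q \in rem p L -> ~ ((q : set R) `<=` p).
    move=> q; rewrite mem_rem_uniq // inE => /andP[/eqP nqp qL] qp.
    exact/nqp/minp.
  elim: (rem p L) => [_|q l IHl nl]; first by exists 1; split=> //; case: (specP p).
  have [|x [xl nxp]] := IHl; first by move=> q' lq'; apply: nl; rewrite inE lq' orbT.
  have /existsNP[y /not_implyP[qy npy]] := nl q (mem_head _ _).
  exists (x * y); split; last exact: specM.
  move=> q'; rewrite inE => /orP[/eqP ->|/xl q'x].
    by have [[_ _ qM] _ _] := specP q; apply: qM.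
  by have [[_ _ qM] _ _] := specP q'; rewrite mulrC; apply: qM.
(* Preserving the largest admissible exponent at [p] preserves all the smaller ones. *)
pose good t := (t <= r.+1)%N /\ splits_at p t (pair_hom Psi h).
have [|| t [tr tP] tmax] := @exists_maximizer nat good id r.+1.
- by move=> t [].
- by exists 0%N; split=> //; apply: splits_at0.
have [c' c'P] : exists c', splits_at p t (perturb (perturb Psi h a c) (mor_scale phi x h) a c').
  apply: splits_at_perturb => //; first exact: splits_at_shear.
  have [f [b fb]] := jointly_split_perturb h c joint; exists f, b, 1.
  by split=> [|v]; [case: (specP p) | rewrite fb rscale1].
exists (c + mor_scale phi x c') => q t' qL le_t' qS.
have [qp|nqp] := eqVneq q p.
  rewrite qp in qS *; rewrite -perturb_scale.
  by apply: splits_at_le c'P; apply: tmax.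
have qL' : q \in rem p L by rewrite mem_rem_uniq // inE nqp.
have -> : perturb Psi h a (c + mor_scale phi x c') =
    perturb Psi h a c + mor_scale phi x (mor_comp h (mor_comp c' (twist r a : mor _ _))).
  apply: mor_ext => v; rewrite morDE mor_scaleE !mor_compE !perturbE morDE mor_scaleE.
  by rewrite mor_linearD mor_rscale addrA.
by apply: splits_at_congr; [apply: xL | apply: cP].
Qed.

(** * Reduction to a single homomorphism *)

Section Induction.
(** [dim_ge p k] stands for the dimension at [p] being at least [k]; lower bounds treat finite and
    infinite dimension alike. *)
Variables (X : set (spec R)) (dim_ge : spec R -> nat -> Prop).
Hypothesis dim_ge0 : forall p, X p -> dim_ge p 0.
Hypothesis dim_geS : forall (p q : spec R) k, X p -> X q -> (p : set R) `<=` q ->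
  p <> q -> dim_ge q k -> dim_ge p k.+1.
Hypothesis finite_components : forall E : set R, exists L : seq (spec R),
  (forall p, p \in L -> X p /\ E `<=` p) /\
  (forall q, X q -> E `<=` q -> exists2 p, p \in L & (p : set R) `<=` q).

Lemma basic_element r (Psi : mor (copies r.+1 N) P) (a : endo N) :
  jointly_split Psi a ->
  (forall q k, X q -> dim_ge q k -> (k < r.+1)%N -> splits_at q k.+1 Psi) ->
  exists h : mor N P, forall q, X q ->
    splits_at q 1 (mor_comp Psi i0 + mor_comp h (a : mor _ _)).
Proof.
elim: r Psi => [|r IH] Psi joint dimPsi.
  exists 0 => q Xq; have [B [A [s [ns AB]]]] := dimPsi q 0%N Xq (dim_ge0 Xq) isT.
  exists (mor_comp (component N ord0) B), A, s; split=> // v.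
  rewrite morDE !mor_compE mor0E addr0 -AB; congr (A (Psi _)).
  by apply/ffunP => i; rewrite injectE (ord1 i) eqxx.
have [widen widenE] : exists w : mor (copies r.+1 N) (copies r.+2 N), forall x i,
    w x i = if unlift ord_max i is Some j then x j else 0.
  exists (row_hom (fun i => if unlift ord_max i is Some j then component N j else 0)) => x i.
  by rewrite row_homE; case: unlift.
pose Psi' := mor_comp Psi widen; pose h := mor_comp Psi (inject N ord_max).
have widen_i0 x : widen (i0 x) = i0 x.
  apply/ffunP => i; rewrite widenE injectE; case: unliftP => [j ->|->].
    by rewrite injectE -!val_eqE /= /bump leqNgt ltn_ord.
  by [].
have joint' : jointly_split Psi' a.
  by have [f [b fb]] := joint; exists f, b => x; rewrite mor_compE widen_i0.
have pair_split q t : splits_at q t Psi -> splits_at q t (pair_hom Psi' h).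
  move=> [B [A [s [ns AB]]]].
  pose cut : mor (copies r.+2 N) (copies r.+1 N) :=
    row_hom (fun j => component N (lift ord_max j)).
  exists (prod_hom (mor_comp cut B) (mor_comp (component N ord_max) B)), A, s.
  split=> // v; rewrite -AB prod_homE pair_homE !mor_compE -mor_linearD.
  congr (A (Psi _)); apply/ffunP => i; rewrite ffunE widenE injectE.
  case: unliftP => [j ->|->]; last by rewrite eqxx add0r.
  by rewrite row_homE eq_sym (negPf (neq_lift _ _)) addr0.
have [L LP] : exists L : seq (spec R), forall q t, X q -> (t < r.+2)%N ->
    ~ splits_at q t.+1 (pair_hom Psi' h) ->
    exists p, [/\ p \in L, X p, (p : set R) `<=` q & ~ splits_at p t.+1 (pair_hom Psi' h)].
  (* The locus where t + 1 copies fail to split consists of the primes containing [E t], so its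
     generic points in [X] are finite in number. *)
  pose E t : set R := [set s | exists (B : mor (copies t.+1 N) _) (A : mor P _),
    forall x, A (pair_hom Psi' h (B x)) = rs s x].
  have EP p t : ~ splits_at p t.+1 (pair_hom Psi' h) <-> E t `<=` p.
    split=> [nsplit s [B [A AB]]|Ep [B [A [s [ns AB]]]]].
      by apply: contrapT => ns; apply: nsplit; exists B, A, s.
    by apply: ns; apply: Ep; exists B, A.
  have /choice[L LP] := fun t => finite_components (E t).
  exists (flatten [seq L t | t <- iota 0 r.+2]) => q t Xq lt_tr /EP Eq.
  have [/(_ _)LX /(_ q Xq Eq)[p pL pq]] := LP t.
  have [Xp Ep] := LX p pL; exists p; split=> //; last exact/EP.
  by apply/flatten_mapP; exists t => //; rewrite mem_iota.
have [c cP] := perturb_finitely_many h joint' (undup_uniq L).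
have [|h' h'P] := IH _ (jointly_split_perturb h c joint').
  move=> q k Xq qk lt_kr.
  (* With [k] + 2 copies before the drop, one may be lost. Otherwise [q] contains some [p] of [L]
     where [k] + 2 copies fail too; if [p] were strictly smaller, its dimension would exceed [k] and
     force them to split. So [p = q], where [c] preserves the exponent. *)
  have [full|nfull] := pselect (splits_at q k.+2 (pair_hom Psi' h)).
    have n1 : ~ (q : set R) 1 by case: (specP q).
    have := splits_at_shear a c n1 full.
    exact: splits_at_drop.
  have [p [pL Xp pq npfull]] := LP q k.+1 Xq lt_kr nfull.
  have [epq|npq] := pselect (p = q).
    apply: cP => //; first by rewrite -epq mem_undup.
    by apply: pair_split; apply: dimPsi => //; apply: ltnW.
  case: npfull; apply: pair_split; apply: dimPsi => //.
  exact: dim_geS qk.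
exists (mor_comp h (mor_comp c i0) + h') => q Xq.
have -> : mor_comp Psi i0 + mor_comp (mor_comp h (mor_comp c i0) + h') (a : mor _ _) =
    mor_comp (perturb Psi' h a c) i0 + mor_comp h' (a : mor _ _).
  apply: mor_ext => x; rewrite !morDE !mor_compE morDE !mor_compE perturbE.
  by rewrite mor_compE widen_i0 twist_i0 addrA.
exact: h'P.
Qed.

Hypothesis X_maximal : forall q : spec R, maximal_ideal (q : set R) ->
  X q \/ exists s, ~ (q : set R) s /\ forall x : N, rs s x = 0.
Hypothesis P_splits : forall q k, X q -> dim_ge q k -> splits_at q k.+1 (mor_id P).
Hypothesis P_fg : finitely_generated P.

Theorem split_modification (m : mor N P) (a b : endo N) (f : mor P N) :
  (forall x, f (m x) + b (a x) = x) ->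
  exists (h : mor N P) (g : mor P N), forall x, g (m x + h (a x)) = x.
Proof.
move=> fb.
have [n [u uP]] := rhom_finitely_generated noethR S_finite N_fg P_fg.
have [Psi PsiE] : exists Psi : mor (copies n.+1 N) P, forall x,
    Psi x = m (x ord0) + \sum_(i < n) (u i : mor N P) (x (lift ord0 i)).
  exists (mor_comp m (component N ord0) +
    \sum_(i < n) mor_comp (u i) (component N (lift ord0 i))) => x.
  by rewrite morDE mor_sumE.
have Psi_i0 x : Psi (i0 x) = m x.
  rewrite PsiE injectE eqxx big1 ?addr0 // => i _.
  by rewrite injectE mor_linear0.
have [|q k Xq qk _|h hP] := @basic_element n Psi a.
- by exists f, b => x; rewrite Psi_i0.
- have [B [A [s [ns AB]]]] := P_splits Xq qk.
  have /choice[c cP] : forall j, exists c : 'I_n -> R, forall x,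
      B (inject N j x) = \sum_(i < n) rs (c i) ((u i : mor N P) x).
    move=> j; have [c cE] := uP (mor_comp B (inject N j)); exists c => x.
    have := congr1 (fun f : mor N P => f x) cE; rewrite mor_compE => ->.
    exact: mor_sumE.
  (* The columns of [B] are combinations of the generators [u i], so [B] factors through [Psi], with
     coefficient 0 at [m]. *)
  pose B' : mor (copies k.+1 N) (copies n.+1 N) := row_hom (fun i =>
    if unlift ord0 i is Some i' then
      \sum_(j < k.+1) mor_scale phi (c j i') (component N j) else 0).
  exists B', A, s; split=> // v; rewrite -AB; congr (A _).
  rewrite PsiE row_homE unlift_none mor0E mor_linear0 add0r.
  have vE : v = \sum_(j < k.+1) inject N j (v j).
    apply/ffunP => i; rewrite sum_ffunE (bigD1 i) //= injectE eqxx.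
    by rewrite big1 ?addr0 // => j /negPf ij; rewrite injectE eq_sym ij.
  have -> : mor_id P (B v) = \sum_(j < k.+1) \sum_(i < n) rs (c j i) ((u i : mor N P) (v j)).
    have := mor_linear_sum B (fun j => inject N j (v j)); rewrite -vE => Bv.
    by rewrite [LHS]Bv; apply: eq_bigr => j _; rewrite cP.
  rewrite exchange_big /=; apply: eq_bigr => i _.
  rewrite row_homE liftK mor_sumE mor_linear_sum; apply: eq_bigr => j _.
  by rewrite mor_scaleE mor_rscale.
exists h; pose Phi := m + mor_comp h (a : mor _ _).
pose I := [set s : R | exists g : mor P N, forall x, g (Phi x) = rs s x].
have I1 : I 1.
  apply: contrapT => nI1.
  have idI : ideal I.
    split; first by exists 0 => x; rewrite rscale0l.
      move=> s t [g gP] [g' g'P]; exists (g + g') => x.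
      by rewrite morDE gP g'P rscaleDl.
    move=> r s [g gP]; exists (mor_scale phi r g) => x.
    by rewrite mor_scaleE gP rscaleA.
  have [q maxq Iq] := exists_maximal_ideal noethR idI nI1.
  pose q' := Spec (maximal_prime maxq).
  case: (X_maximal (maxq : maximal_ideal (q' : set R))) => [Xq|[s [ns s0]]]; last first.
    by apply: ns; apply: Iq; exists 0 => x; rewrite s0.
  have [B [A [s [ns AB]]]] := hP q' Xq.
  pose al : endo N := mor_comp (component N ord0) (mor_comp A Phi).
  pose be : endo N := mor_comp B (inject N ord0).
  (* With [eta] = 0 the stable range property is Dedekind finiteness at [q']: the right inverse [be]
     makes [al] a local unit, so [Phi] itself has a local left inverse. *)
  have [||c [v [s' [ns' vP _]]]] :=
    @unit_completion_endo R S phi noethR S_finite q' N al 0 1 N_fg.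
  - exists be, 0, s; split=> // x.
    have := congr1 (fun z : copies 1 N => z ord0) (AB (i0 x)).
    rewrite rscale_ffun injectE eqxx => <-.
    by rewrite mor_linear0 addr0 /al /be !mor_compE !morDE !mor_compE Psi_i0.
  - exists 0, 1, 1; split; first by case: (specP q').
    by move=> x; rewrite mor0E add0r !endo1E rscale1.
  apply: ns'; apply: Iq; exists (mor_comp v (mor_comp (component N ord0) A)) => x.
  by rewrite -vP mor0E addr0.
have [g gP] := I1; exists g => x.
by have := gP x; rewrite rscale1.
Qed.

End Induction.
End BasicElements.

(** * Krull dimension *)

Section Subspaces.
Variables (T : topologicalType) (C : set T).

Lemma subspace_closedP (Z : set C) :
  closed Z <-> exists2 K, closed K & Z = set_val @^-1` K.
Proof.
rewrite -openC; split=> [[V oV VZ]|[K cK ->]].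
  exists (~` V); first exact: open_closedC.
  by rewrite -preimage_setC VZ setCK.
by exists (~` K); [exact: closed_openC | rewrite preimage_setC].
Qed.

(** Chains are taken in the ambient space, so that those in the closures of two points can be
    compared. *)
Definition chain_in (D : set T) (n : nat) (W : nat -> set T) : Prop :=
  (forall i, (i <= n)%N -> [/\ closed (W i), irreducible (W i) & W i `<=` D]) /\
  (forall i j, (i < j <= n)%N -> W i `<` W j).

Lemma subspace_chainP n : closed C ->
  (exists Z : 'I_n.+1 -> set C, closed_irreducible_chain Z) <->
  (exists W, chain_in C n W).
Proof.
move=> cC; split=> [[Z [Zirr Zlt]]|[W [Wirr Wlt]]].
  exists (fun i => set_val @` Z (inord i)); split=> [i le_in|i j /andP[lt_ij le_jn]].
    have [/subspace_closedP[K cK ZK] [[x Zx] irrZ]] := Zirr (inord i); split.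
    - have -> : set_val @` Z (inord i) = K `&` C.
        apply/seteqP; split=> [_ [y Zy <-]|y [Ky Cy]].
          by split; [move: Zy; rewrite ZK | exact: set_valP].
        by exists (SigSub (mem_set Cy)); rewrite ?ZK.
      exact: closedI.
    - split; first by exists (set_val x); exists x.
      move=> A B cA cB ZAB.
      have [|||ZA|ZB] := irrZ (set_val @^-1` A) (set_val @^-1` B).
      + by apply/subspace_closedP; exists A.
      + by apply/subspace_closedP; exists B.
      + by move=> y Zy; apply: ZAB; exists y.
      + by left=> _ [y Zy <-]; apply: ZA.
      + by right=> _ [y Zy <-]; apply: ZB.
    - by move=> _ [y _ <-]; exact: set_valP.
  have [|Zij nZji] := Zlt (inord i) (inord j).
    by rewrite !inordK // ltnS ?(leq_trans (ltnW lt_ij)).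
  split; first by move=> _ [y Zy <-]; exists y => //; exact: Zij.
  by move=> sub; apply: nZji => y Zy; have [|z Zz /val_inj <-] := sub (set_val y); first by exists y.
exists (fun i : 'I_n.+1 => set_val @^-1` W i); split=> [i|i j lt_ij].
  have [cW [[x Wx] irrW] WC] := Wirr i (ltn_ord i); split.
    by apply/subspace_closedP; exists (W i).
  split; first by exists (SigSub (mem_set (WC _ Wx))).
  move=> A B /subspace_closedP[A' cA' ->] /subspace_closedP[B' cB' ->] WAB.
  have [|WA|WB] := irrW A' B' cA' cB'.
  - move=> y Wy; exact: (WAB (SigSub (mem_set (WC _ Wy))) Wy).
  - by left=> y; exact: WA.
  - by right=> y; exact: WB.
have [|Wij nWji] := Wlt i j; first by rewrite lt_ij /=; exact: (ltn_ord j).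
split; first by move=> y; exact: Wij.
move=> sub; apply: nWji => y Wy.
have [_ _ WC] := Wirr j (ltn_ord j).
exact: (sub (SigSub (mem_set (WC _ Wy))) Wy).
Qed.

End Subspaces.

Definition onat_ge (d : option nat) (k : nat) : Prop :=
  if d is Some d then (k <= d)%N else True.

Lemma nat_sup_ge (A : set nat) n : A n -> onat_ge (nat_sup A) n.
Proof.
rewrite /nat_sup => An; case: pselect => //= exA.
by case: ex_minnP => m /asboolP ubm _; exact: ubm.
Qed.

(** A member [n] is supplied because the empty set has supremum 0 without attaining it. *)
Lemma nat_sup_geP (A : set nat) n k : A n -> onat_ge (nat_sup A) k ->
  exists2 m, A m & (k <= m)%N.
Proof.
rewrite /nat_sup => An; case: pselect => [exA|nexA] /=.
  case: ex_minnP => m /asboolP ubm minm le_km; apply: contrapT => none.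
  have lt_jk j : A j -> (j < k)%N.
    by move=> Aj; rewrite ltnNge; apply/negP => le_kj; apply: none; exists j.
  have := lt_jk n An; case: k le_km {none} lt_jk => // k le_km lt_jk _.
  have : (m <= k)%N by apply: minm; apply/asboolP => j /lt_jk.
  by rewrite leqNgt le_km.
move=> _; apply: contrapT => none; apply: nexA; exists k; apply/asboolP => j Aj.
by rewrite leEnat leqNgt; apply/negP => /ltnW le_kj; apply: none; exists j.
Qed.

Lemma closure1_irreducible (T : topologicalType) (x : T) : irreducible (closure [set x]).
Proof.
have xx : closure [set x] x by apply: subset_closure.
split; first by exists x.
move=> A B cA cB sub.
have cl (D : set T) : closed D -> D x -> closure [set x] `<=` D.
  by move=> cD Dx; rewrite closureE => y; apply; split=> // _ ->.
by case: (sub x xx) => ?; [left|right]; apply: cl.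
Qed.

Lemma onat_ge_le d k k' : (k' <= k)%N -> onat_ge d k -> onat_ge d k'.
Proof. by case: d => //= d; exact: leq_trans. Qed.

Lemma dim_at_strict (T : topologicalType) (X : set T) (x y : X) k :
  closure [set x] y -> ~ closure [set y] x ->
  onat_ge (dim_at y) k -> onat_ge (dim_at x) k.+1.
Proof.
move=> xy nyx; rewrite /dim_at /krull_dim => yk.
have cl_xy : closure [set y] `<=` closure [set x].
  rewrite [X in X `<=` _]closureE => z; apply.
  by split; [exact: closed_closure | move=> _ ->].
have cc (z : X) := @closed_closure _ [set z].
have [m [W [Wirr Wlt]] le_km] : exists2 m, (exists W, chain_in (closure [set y]) m W) & (k <= m)%N.
  have [|m mP le_km] := @nat_sup_geP _ 0%N k _ yk.
    apply/(subspace_chainP 0 (cc y)); exists (fun=> closure [set y]).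
    split; last by move=> i j /andP[lt_ij]; rewrite leqNgt (leq_ltn_trans _ lt_ij).
    by move=> i _; split=> //; exact: closure1_irreducible.
  by exists m => //; apply/(subspace_chainP m (cc y)).
apply: (@onat_ge_le _ m.+1); first by rewrite ltnS.
apply: nat_sup_ge; apply/(subspace_chainP m.+1 (cc x)).
(* The closure of [x] is put on top of a chain in the closure of [y]. *)
exists (fun i => if (i <= m)%N then W i else closure [set x]); split=> [i le_im|i j].
  case: ifP => [/Wirr[cW irrW Wy]|_].
    by split=> //; exact: subset_trans cl_xy.
  by split=> //; exact: closure1_irreducible.
move=> /andP[lt_ij le_jm].
have le_im : (i <= m)%N by rewrite -ltnS; exact: leq_trans le_jm.
rewrite le_im; case: ifP => [le_jm'|_]; first by apply: Wlt; rewrite lt_ij.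
have [_ _ Wy] := Wirr i le_im; split; first exact: subset_trans cl_xy.
by move=> xW; apply: nyx; apply: Wy; apply: xW; apply: subset_closure.
Qed.

Section Spectrum.
Variable R : comPzRingType.

Lemma closed_zero_locus (E : set R) : closed (zero_locus E).
Proof. by rewrite -openC; exists E. Qed.

Lemma closure_spec (X : set (spec R)) (x y : X) :
  closure [set x] y <-> (\val x : set R) `<=` (\val y : spec R).
Proof.
split=> [xy|xy].
  have cK : closed (set_val @^-1` zero_locus (\val x : set R) : set X).
    by apply/subspace_closedP; exists (zero_locus (\val x : set R)) => //; exact: closed_zero_locus.
  have : (set_val @^-1` zero_locus (\val x : set R) : set X) y.
    by move: xy; rewrite closureE; apply; split=> // _ ->.
  by [].
rewrite closureE => K [/subspace_closedP[K' cK' ->] xK].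
move: cK'; rewrite -openC => -[E KE].
have {}KE : K' = zero_locus E by rewrite -[LHS]setCK KE setCK.
rewrite KE; apply: subset_trans xy.
have := xK x erefl; rewrite KE; exact.
Qed.

End Spectrum.

(** * Localized homomorphisms and components *)

Section Localization.
Variables (R : comPzRingType) (S : pzRingType) (phi : algebra_on R S).
Hypothesis noethR : noetherian R.
Hypothesis S_finite : module_finite phi.
Local Notation rs := (rscale phi).

Section CommonDenominator.
Variable p : spec R.

Lemma common_denominator (I : finType) (d : I -> denom p) :
  exists (D : denom p) (e : I -> R), forall i, dval D = e i * dval (d i).
Proof.
have nD : ~ (p : set R) (\prod_i dval (d i)).
  apply: (big_ind (fun x => ~ (p : set R) x)) => [||i _];
    [by case: (specP p) | exact: specM | exact: denomP].
exists (Denom nD), (fun i => \prod_(j | j != i) dval (d j)) => i /=.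
by rewrite (bigD1 i) //= mulrC.
Qed.

Lemma mfrac_eqP (A : lmodType S^c) (x y : A) (u v : denom p) :
  mfrac phi x u = mfrac phi y v <->
  exists w, ~ (p : set R) w /\ rs w (rs (dval v) x) = rs w (rs (dval u) y).
Proof.
split=> [/frac_eqP[w e]|[w [nw e]]]; first by exists (dval w); split=> //; exact: denomP.
by apply/frac_eqP; exists (Denom nw).
Qed.

Lemma mfrac_scale (A : lmodType S^c) (x : A) (u v : denom p) r :
  dval v = r * dval u -> mfrac phi x u = mfrac phi (rs r x) v.
Proof.
move=> vE; apply: frac_eq_sim; rewrite vE mulrC.
exact: (esym (rscaleA phi (dval u) r x)).
Qed.

Lemma mfracDl (A : lmodType S^c) (x y : A) (u : denom p) :
  mfrac phi (x + y) u = mfrac phi x u + mfrac phi y u.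
Proof.
rewrite mfracD -scalerDr; apply: frac_eq_sim => /=.
by rewrite scalerA.
Qed.

Lemma mfrac0 (A : lmodType S^c) (u : denom p) : mfrac phi (0 : A) u = 0.
Proof. exact: frac0. Qed.

Lemma mfrac_sum (A : lmodType S^c) n (x : 'I_n -> A) (u : denom p) :
  mfrac phi (\sum_(i < n) x i) u = \sum_(i < n) mfrac phi (x i) u.
Proof.
apply: (big_morph (fun x => mfrac phi x u)) => [y z|]; [exact: mfracDl | exact: mfrac0].
Qed.

Lemma mfrac_actl (A : lmodType S^c) (s : S) (x : A) (u : denom p) :
  (afrac phi s (denom1 p) : (loc_alg phi p)^c) *: mfrac phi x u =
  mfrac phi ((s : S^c) *: x) u.
Proof.
by rewrite mfracZ; apply: frac_eq_sim; rewrite /= mul1r.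
Qed.

Lemma mfrac_den (A : lmodType S^c) (x : A) (u v : denom p) :
  (afrac phi 1 u : (loc_alg phi p)^c) *: mfrac phi x v = mfrac phi x (denomM u v).
Proof. by rewrite mfracZ scale1r. Qed.

End CommonDenominator.

Lemma supp_annihilator (N : lmodType S^c) (p : spec R) s :
  supp phi N p -> (forall x : N, rs s x = 0) -> (p : set R) s.
Proof.
move=> [z /eqP zn0] s0; apply: contrapT => ns; apply: zn0.
have [x [u ->]] := mfracP z; rewrite -(mfrac0 N (denom1 p)); apply/mfrac_eqP.
by exists s; rewrite !s0.
Qed.

Lemma annihilator_supp (N : lmodType S^c) (p : spec R) :
  finitely_generated N -> ~ supp phi N p ->
  exists s, ~ (p : set R) s /\ forall x : N, rs s x = 0.
Proof.
move=> [n [g gP]] nsupp.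
have /choice[d dP] : forall i, exists d : denom p, rs (dval d) (g i) = 0.
  move=> i; have /mfrac_eqP[w [nw e]] : mfrac phi (g i) (denom1 p) = mfrac phi 0 (denom1 p).
    by rewrite mfrac0; apply: contrapT => /eqP gn0; apply: nsupp; exists (mfrac phi (g i) (denom1 p)).
  by exists (Denom nw); move: e; rewrite /= rscale0 rscale0 rscale1.
have [D [e De]] := common_denominator d.
exists (dval D); split=> [|x]; first exact: denomP.
have [c ->] := gP x; rewrite rscale_sumr big1 // => i _.
by rewrite rscaleZ (De i) -rscaleA dP rscale0 scaler0.
Qed.

Section Lift.
Variables (p : spec R) (N P : lmodType S^c).
Local Notation loc A := (loc_mod phi p A).

Lemma mor_loc_lift (u : mor (loc N) (loc P)) : finitely_generated N ->
  exists (d : denom p) (v : mor N P),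
    forall x, u (mfrac phi x (denom1 p)) = mfrac phi (v x) d.
Proof.
move=> [n [g gP]].
have /choice[y yP] : forall i, exists y : P * denom p,
    u (mfrac phi (g i) (denom1 p)) = mfrac phi y.1 y.2.
  move=> i; have [y [d e]] := mfracP (u (mfrac phi (g i) (denom1 p))).
  by exists (y, d).
have [D [e De]] := common_denominator (fun i => (y i).2).
pose z i := rs (e i) (y i).1.
have uz i : u (mfrac phi (g i) (denom1 p)) = mfrac phi (z i) D.
  by rewrite yP (mfrac_scale _ (De i)).
clearbody z; clear y yP De.
pose comb (A : lmodType S^c) (h : 'I_n -> A) (c : {ffun 'I_n -> Defs.restrict phi (S^c)^o}) : A :=
  \sum_(i < n) (c i : S^c) *: h i.
have comb_u c : u (mfrac phi (comb N g c) (denom1 p)) = mfrac phi (comb P z c) D.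
  rewrite !mfrac_sum mor_linear_sum; apply: eq_bigr => i _.
  by rewrite -mfrac_actl [LHS]linearZ -mfrac_actl; congr (_ *: _); exact: uz.
have combB A h c c' : comb A h (c - c') = comb A h c - comb A h c'.
  by rewrite -sumrB; apply: eq_bigr => i _; rewrite !ffunE scalerBl.
have combD (A : lmodType S^c) h c c' : comb A h (c + c') = comb A h c + comb A h c'.
  by rewrite -big_split; apply: eq_bigr => i _; rewrite !ffunE scalerDl.
have combZ (A : lmodType S^c) h r c : comb A h (r *: c) = rs r (comb A h c).
  rewrite rscale_sumr; apply: eq_bigr => i _; rewrite ffunE restrict_regularZ.
  by rewrite alg_map_central /rscale scalerA.
have comb0 (A : lmodType S^c) h : comb A h 0 = 0.
  by rewrite -(subrr 0) combB subrr.
have comb_act (A : lmodType S^c) h (s : S^c) (c : {ffun 'I_n -> Defs.restrict phi (S^c)^o}) :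
    comb A h [ffun i => s * (c i : S^c)] = s *: comb A h c.
  by rewrite scaler_sumr; apply: eq_bigr => i _; rewrite ffunE scalerA.
have [l lT] := (lspanT_finitely_generated _).1 (finitely_generated_ffun n S_finite).
(* The relations between the generators form a finitely generated [R]-module, so one scalar [W]
   outside [p] kills all their images in [P], and [W] times the obvious assignment is well
   defined. *)
pose U := [set c | comb N g c = 0].
have sU : submodule U.
  split; first exact: comb0.
    by move=> c c' Uc Uc'; rewrite /U /= combD Uc Uc' addr0.
  by move=> r c Uc; rewrite /U /= combZ Uc rscale0.
have [|l' l'U] := @noetherian_submodule _ _ l U noethR sU; first by rewrite lT.
have [W [nW WP]] : exists W, ~ (p : set R) W /\
    forall c, c \in l' -> rs W (comb P z c) = 0.
  have : forall c, c \in l' -> U c by rewrite -l'U => c /lspan_mem.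
  elim: {l'U} l' => [|c l' IH] l'U; first by exists 1; split=> //; case: (specP p).
  have [|W [nW WP]] := IH; first by move=> c' lc'; apply: l'U; rewrite inE lc' orbT.
  have /mfrac_eqP[w [nw]] : mfrac phi (comb P z c) D = mfrac phi 0 D.
    by rewrite -comb_u (l'U c) ?mem_head // !mfrac0 mor_linear0.
  rewrite !rscale0 rscaleA => wc; exists (w * dval D * W); split.
    by apply: specM => //; apply: specM => //; exact: denomP.
  move=> c'; rewrite inE => /orP[/eqP ->|/WP Wc].
    by rewrite mulrC -rscaleA wc rscale0.
  by rewrite -rscaleA Wc rscale0.
have {}WP c : U c -> rs W (comb P z c) = 0.
  rewrite -l'U; apply: (@lspan_sub _ _ l' (fun c => rs W (comb P z c) = 0)) => //.
  split; first by rewrite comb0 rscale0.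
    by move=> a b a0 b0; rewrite combD rscaleDr a0 b0 addr0.
  by move=> r a a0; rewrite combZ rscaleC a0 rscale0.
have /choice[gamma gammaP] : forall x, exists c, x = comb N g c.
  move=> x; have [c ->] := gP x; exists (finfun c).
  by apply: eq_bigr => i _; rewrite ffunE.
have v_linear : linear (fun x => rs W (comb P z (gamma x))).
  move=> a x y.
  pose c := [ffun i => a * (gamma x i : S^c)] + gamma y : {ffun 'I_n -> Defs.restrict phi (S^c)^o}.
  have : rs W (comb P z (gamma (a *: x + y) - c)) = 0.
    by apply: WP; rewrite /U /= combB -gammaP combD comb_act -!gammaP subrr.
  rewrite combB rscaleB => /subr0_eq ->.
  by rewrite combD comb_act rscaleDr rscaleZ.
have nWD : ~ (p : set R) (W * dval D) by apply: specM => //; exact: denomP.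
exists (Denom nWD), (Mor v_linear) => x /=.
by rewrite {1}(gammaP x) comb_u; apply: mfrac_scale.
Qed.

End Lift.

Lemma mor_loc_lift_family (p : spec R) (N P : lmodType S^c) (I : finType)
    (u : I -> mor (loc_mod phi p N) (loc_mod phi p P)) : finitely_generated N ->
  exists (d : denom p) (v : I -> mor N P),
    forall i x, u i (mfrac phi x (denom1 p)) = mfrac phi (v i x) d.
Proof.
move=> N_fg; have /choice[dv dvP] : forall i, exists dv : denom p * mor N P,
    forall x, u i (mfrac phi x (denom1 p)) = mfrac phi (dv.2 x) dv.1.
  by move=> i; have [d [v vP]] := mor_loc_lift (u i) N_fg; exists (d, v).
have [D [e De]] := common_denominator (fun i => (dv i).1).
exists D, (fun i => mor_scale phi (e i) (dv i).2) => i x.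
by rewrite dvP (mfrac_scale _ (De i)).
Qed.

Lemma isomorphic_mor (T : pzRingType) (A B : lmodType T) : isomorphic A B ->
  exists (f : mor A B) (g : mor B A), cancel f g /\ cancel g f.
Proof.
move=> [f [g fK gK]].
have g_linear : linear g.
  by move=> a x y; apply: (can_inj fK); rewrite linearP !gK.
by exists (mor_of f), (Mor g_linear).
Qed.

(** The splitting is lifted entry by entry, as a matrix of maps, so the localization of [copies n N]
    need not be compared with copies of the localization. *)
Lemma direct_summand_splits (p : spec R) (N P : lmodType S^c) n :
  finitely_generated N -> finitely_generated P ->
  direct_summand (copies n (loc_mod phi p N)) (loc_mod phi p P) ->
  splits_at phi N p n (mor_id P).
Proof.
move=> N_fg P_fg [C /isomorphic_mor[f [g [fK gK]]]].
pose Bh i := mor_comp f (prod_hom (inject (loc_mod phi p N) i) (0 : mor _ C)).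
pose Ah i := mor_comp (component _ i) (mor_comp (fst_hom _ _) g).
have AhBh i j x : Ah i (Bh j x) = if i == j then x else 0.
  by rewrite /Ah /Bh !mor_compE fK componentE fst_homE prod_homE injectE.
have [db [B BP]] := mor_loc_lift_family Bh N_fg.
have [da [A AP]] := mor_loc_lift_family Ah P_fg.
have AB i j x : exists w : denom p, rs (dval w) (A i (B j x)) =
    rs (dval w * dval (denomM db da)) (if i == j then x else 0).
  have : mfrac phi (A i (B j x)) (denomM db da) =
      mfrac phi (if i == j then x else 0) (denom1 p).
    rewrite -mfrac_den -AP -[LHS]linearZ mfrac_den.
    have -> : mfrac phi (B j x) (denomM db (denom1 p)) = mfrac phi (B j x) db.
      by apply: frac_eq_sim; rewrite /= mulr1.
    rewrite -BP; have := AhBh i j (mfrac phi x (denom1 p)); rewrite /= => ->.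
    by case: eqP; rewrite ?mfrac0.
  move=> /mfrac_eqP[w [nw e]]; exists (Denom nw) => /=.
  by rewrite -rscaleA -e rscale1.
have [m [h hP]] := N_fg.
have /choice[w wP] : forall k : 'I_n * 'I_n * 'I_m, exists w : denom p,
    rs (dval w) (A k.1.1 (B k.1.2 (h k.2))) =
    rs (dval w * dval (denomM db da)) (if k.1.1 == k.1.2 then h k.2 else 0).
  by move=> k; exact: AB.
(* The scalar that makes a lifted identity hold depends on the element; over the finitely many
   generators of [N] and all entries one scalar suffices. *)
have [W [e We]] := common_denominator w.
have {}AB i j x : rs (dval W) (A i (B j x)) =
    rs (dval W * dval (denomM db da)) (if i == j then x else 0).
  have H k : rs (dval W) (A i (B j (h k))) =
      rs (dval W * dval (denomM db da)) (if i == j then h k else 0).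
    by rewrite (We (i, j, k)) -rscaleA wP rscaleA mulrA.
  have [c ->] := hP x.
  pose q := if i == j then mor_id N else 0.
  have qE y : (if i == j then y else 0) = q y by rewrite /q; case: eqP.
  have {}H k : rs (dval W) (A i (B j (h k))) = rs (dval W * dval (denomM db da)) (q (h k)).
    by rewrite H qE.
  rewrite qE; clearbody q; rewrite !mor_linear_sum !rscale_sumr.
  apply: eq_bigr => k _.
  rewrite [B j _]linearZ [A i _]linearZ [q _]linearZ.
  by rewrite !rscaleZ H.
have [Bs BsE] : exists Bs : mor (copies n N) P, forall v, Bs v = \sum_(j < n) B j (v j).
  by exists (\sum_(j < n) mor_comp (B j) (component N j)) => v; rewrite mor_sumE.
exists Bs,
  (row_hom (fun i => mor_scale phi (dval W) (A i))), (dval W * dval (denomM db da)).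
split=> [|v]; first by apply: specM; exact: denomP.
apply/ffunP => i; rewrite row_homE mor_scaleE rscale_ffun.
rewrite mor_idE BsE mor_linear_sum rscale_sumr.
rewrite (bigD1 i) //= AB eqxx big1 ?addr0 // => j /negPf ij.
by rewrite AB eq_sym ij rscale0.
Qed.

End Localization.

(** * Generic points of the closed subsets of X *)

Section Components.
Variables (R : comPzRingType) (S : pzRingType) (phi : algebra_on R S) (N : lmodType S^c).
Hypothesis noethR : noetherian R.
Hypothesis N_fg : finitely_generated N.
Let X : set (spec R) := jspec R `&` supp phi N.

Lemma maximal_jspec (m : spec R) : maximal_ideal (m : set R) -> jspec R m.
Proof.
by move=> maxm; exists [set (m : set R)]; rewrite ?bigcap_set1 // => _ ->.
Qed.

(* If the intersection of the points of [X] above [I] is not prime, it contains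
   a product [x * y] with [x] and [y] outside, and each point of [X] above [I]
   lies above [I + (x)] or [I + (y)]. *)
Lemma finite_components_ideal (I : set R) : ideal I ->
  exists L : seq (spec R), (forall p, p \in L -> X p /\ I `<=` p) /\
    (forall q, X q -> I `<=` q -> exists2 p, p \in L & (p : set R) `<=` q).
Proof.
move: I; apply: noetherian_ind => // I idI IH.
pose J : set R := [set x | forall q, X q -> I `<=` q -> (q : set R) x].
have IJ : I `<=` J by move=> x Ix q _; apply.
have idJ : ideal J.
  split; first by move=> q _ _; have [[]] := specP q.
    move=> x y Jx Jy q Xq Iq; have [[_ qD _] _ _] := specP q.
    by apply: qD; [apply: Jx | apply: Jy].
  by move=> r x Jx q Xq Iq; have [[_ _ qM] _ _] := specP q; apply: qM; apply: Jx.
have [noX|/existsNP[q0 /not_implyP[Xq0 /contrapT Iq0]]] :=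
  pselect (forall q, X q -> ~ (I `<=` (q : set R))).
  by exists [::]; split=> // q /noX.
have nJ1 : ~ J 1 by move=> /(_ q0 Xq0 Iq0); case: (specP q0).
have [Jprime|nJprime] := pselect (forall x y, J (x * y) -> J x \/ J y).
  pose P := Spec (And3 idJ nJ1 Jprime : prime_ideal J).
  exists [:: P]; split=> [p|q Xq Iq]; last first.
    by exists P; rewrite ?mem_head // => x; apply.
  (* The prime [J] belongs to [X]: an intersection of intersections of maximal ideals is one too,
     and a scalar annihilating [N] lies in every point of the support, hence in [J]. *)
  rewrite inE => /eqP ->; split=> //; split.
    exists [set m | maximal_ideal m /\ J `<=` m]; first by move=> m [].
    apply/seteqP; split=> [x Jx m [_ Jm]|x xP q Xq Iq]; first exact: Jm.
    have [[F Fmax qF] _] := Xq; rewrite qF => m Fm; apply: xP; split; first exact: Fmax.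
    by move=> y /(_ q Xq Iq); rewrite qF; apply.
  apply: contrapT => /(annihilator_supp N_fg)[s [nJs s0]]; apply: nJs => q [_ qS] _.
  exact: supp_annihilator s0.
have [x [y [Jxy nJx nJy]]] : exists x y, [/\ J (x * y), ~ J x & ~ J y].
  apply: contrapT => none; apply: nJprime => x y Jxy.
  apply: contrapT => nxy; apply: none; exists x, y.
  by split=> // ?; apply: nxy; [left | right].
pose add z := [set a : R | exists u r, I u /\ a = u + r * z].
have [I0 ID IM] := idI.
have id_add z : ideal (add z).
  split; first by exists 0, 0; rewrite mul0r addr0.
    move=> _ _ [u [r [Iu ->]]] [v [s [Iv ->]]]; exists (u + v), (r + s).
    by split; [apply: ID | rewrite mulrDl addrACA].
  move=> s _ [u [r [Iu ->]]]; exists (s * u), (s * r).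
  by split; [apply: IM | rewrite mulrDr mulrA].
have I_add z : I `<=` add z by move=> u Iu; exists u, 0; rewrite mul0r addr0.
have add_z z : add z z by exists 0, 1; rewrite mul1r add0r.
have n_add z : ~ J z -> ~ (add z `<=` I) by move=> nJz sub; apply: nJz; apply/IJ/sub.
have add_sub z q : I `<=` (q : spec R) -> (q : set R) z -> add z `<=` q.
  move=> Iq qz _ [u [r [Iu ->]]]; have [[_ qD qM] _ _] := specP q.
  by apply: qD; [exact: Iq | exact: qM].
have [Lx [LxX LxP]] := IH _ (id_add x) (@I_add x) (n_add x nJx).
have [Ly [LyX LyP]] := IH _ (id_add y) (@I_add y) (n_add y nJy).
exists (Lx ++ Ly); split=> [p|q Xq Iq].
  rewrite mem_cat => /orP[/LxX|/LyX] [Xp Ap]; split=> //; exact: subset_trans Ap.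
have [_ _ qM] := specP q; have [qx|qy] := qM _ _ (Jxy q Xq Iq).
  have [p pL pq] := LxP q Xq (add_sub _ _ Iq qx).
  by exists p => //; rewrite mem_cat pL.
have [p pL pq] := LyP q Xq (add_sub _ _ Iq qy).
by exists p => //; rewrite mem_cat pL orbT.
Qed.

Lemma finite_components_set (E : set R) :
  exists L : seq (spec R), (forall p, p \in L -> X p /\ E `<=` p) /\
    (forall q, X q -> E `<=` q -> exists2 p, p \in L & (p : set R) `<=` q).
Proof.
pose I : set R := [set x | forall q, X q -> E `<=` q -> (q : set R) x].
have EI : E `<=` I by move=> x Ex q _; apply.
have [|L [LX LP]] := @finite_components_ideal I.
  split; first by move=> q _ _; have [[]] := specP q.
    move=> x y Jx Jy q Xq Iq; have [[_ qD _] _ _] := specP q.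
    by apply: qD; [apply: Jx | apply: Jy].
  by move=> r x Jx q Xq Iq; have [[_ _ qM] _ _] := specP q; apply: qM; apply: Jx.
exists L; split=> [p /LX[Xp Ip]|q Xq Eq]; first by split=> //; exact: subset_trans Ip.
by apply: LP => // x; apply.
Qed.

End Components.

(** * Cancellation *)

Section Isomorphism.
Variable T : pzRingType.
Implicit Types A B C : lmodType T.

Lemma mor_isomorphic A B (f : mor A B) (g : mor B A) :
  cancel f g -> cancel g f -> isomorphic A B.
Proof. by move=> fK gK; exists f; exists g. Qed.

Lemma isomorphic_refl A : isomorphic A A.
Proof. exact: (@mor_isomorphic A A (mor_id A) (mor_id A)). Qed.

Lemma isomorphic_sym A B : isomorphic A B -> isomorphic B A.
Proof. by move=> /isomorphic_mor[f [g [fK gK]]]; exact: (mor_isomorphic gK fK). Qed.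

Lemma isomorphic_trans B A C : isomorphic A B -> isomorphic B C -> isomorphic A C.
Proof.
move=> /isomorphic_mor[f [g [fK gK]]] /isomorphic_mor[f' [g' [fK' gK']]].
apply: (@mor_isomorphic _ _ (mor_comp f' f) (mor_comp g g')) => x.
  by rewrite !mor_compE fK' fK.
by rewrite !mor_compE gK gK'.
Qed.

Lemma isomorphic_prod A A' B B' : isomorphic A A' -> isomorphic B B' ->
  isomorphic (A * B)%type (A' * B')%type.
Proof.
move=> /isomorphic_mor[f [g [fK gK]]] /isomorphic_mor[f' [g' [fK' gK']]].
apply: (@mor_isomorphic _ _
  (prod_hom (mor_comp f (fst_hom A B)) (mor_comp f' (snd_hom A B)))
  (prod_hom (mor_comp g (fst_hom A' B')) (mor_comp g' (snd_hom A' B')))) => -[x y].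
  by rewrite !prod_homE !mor_compE fK fK'.
by rewrite !prod_homE !mor_compE gK gK'.
Qed.

Lemma isomorphic_prodC A B : isomorphic (A * B)%type (B * A)%type.
Proof.
by apply: (@mor_isomorphic _ _ (prod_hom (snd_hom A B) (fst_hom A B))
  (prod_hom (snd_hom B A) (fst_hom B A))) => -[x y].
Qed.

Lemma isomorphic_prodA A B C : isomorphic (A * (B * C))%type ((A * B) * C)%type.
Proof.
by apply: (@mor_isomorphic _ _
  (prod_hom (prod_hom (fst_hom _ _) (mor_comp (fst_hom _ _) (snd_hom _ _)))
    (mor_comp (snd_hom _ _) (snd_hom _ _)))
  (prod_hom (mor_comp (fst_hom _ _) (fst_hom _ _))
    (prod_hom (mor_comp (snd_hom _ _) (fst_hom _ _)) (snd_hom _ _)))) => [[x [y z]]|[[x y] z]].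
Qed.

Lemma isomorphic_prodCA A B C : isomorphic (A * (B * C))%type (B * (A * C))%type.
Proof.
apply: (isomorphic_trans (isomorphic_prodA A B C)).
apply: (@isomorphic_trans ((B * A) * C)%type); last exact/isomorphic_sym/isomorphic_prodA.
by apply: isomorphic_prod; [exact: isomorphic_prodC | exact: isomorphic_refl].
Qed.

Lemma isomorphic_copies0 A B : isomorphic (copies 0 A * B)%type B.
Proof.
apply: (@mor_isomorphic _ _ (snd_hom _ _) (prod_hom 0 (mor_id B))) => [[x y]|//].
by rewrite prod_homE; congr (_, _); apply/ffunP => -[].
Qed.

Lemma isomorphic_copiesS n A : isomorphic (copies n.+1 A) (A * copies n A)%type.
Proof.
apply: (@mor_isomorphic _ _
  (prod_hom (component A ord0) (row_hom (fun i => component A (lift ord0 i))))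
  (row_hom (fun i : 'I_n.+1 => if unlift ord0 i is Some j
     then mor_comp (component A j) (snd_hom _ _) else fst_hom A (copies n A)))) => [x|[x y]].
  apply/ffunP => i; rewrite row_homE prod_homE.
  by case: unliftP => [j ->|->] //; rewrite mor_compE snd_homE componentE row_homE.
rewrite prod_homE; congr (_, _); first by rewrite componentE row_homE unlift_none.
by apply/ffunP => i; rewrite row_homE componentE row_homE liftK.
Qed.

(* With [m' = m + h \o a] split by [g], the automorphisms
   [(x, y) |-> (x, y + h x)], [(x, y) |-> (x + g y - a (g y), y)] and
   [(x, y) |-> (x, y - m' x)] of [N * M] carry the embedding [(a, m)] of [N] to
   the first factor. *)
Lemma cancel_summand (N L M P : lmodType T) :
  (forall (m : mor N P) (a b : endo N) (f : mor P N), (forall x, f (m x) + b (a x) = x) ->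
    exists (h : mor N P) (g : mor P N), forall x, g (m x + h (a x)) = x) ->
  direct_summand P M -> isomorphic (N * L)%type (N * M)%type -> isomorphic L M.
Proof.
move=> modif [Q /isomorphic_mor[k [k' [kK k'K]]]] /isomorphic_mor[th [et [thK etK]]].
pose inl A B : mor A (A * B)%type := prod_hom (mor_id A) 0.
pose inr A B : mor B (A * B)%type := prod_hom 0 (mor_id B).
have th0 x : th (x, 0) = ((th (x, 0)).1, (th (x, 0)).2) by case: (th _).
pose a : endo N := mor_comp (fst_hom _ _) (mor_comp th (inl N L)).
pose mM : mor N M := mor_comp (snd_hom _ _) (mor_comp th (inl N L)).
have thE x : th (x, 0) = (a x, mM x) by exact: th0.
pose b : endo N := mor_comp (fst_hom _ _) (mor_comp et (inl N M)).
pose fM : mor M N := mor_comp (fst_hom _ _) (mor_comp et (inr N M)).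
have bfM x : b (a x) + fM (mM x) = x.
  have : et (a x, 0) + et (0, mM x) = (x, 0).
    by rewrite -mor_linearD -(thK (x, 0)) thE; congr (et (_, _)); rewrite ?addr0 ?add0r.
  by move=> /(congr1 fst).
clearbody a mM b fM; clear th0.
pose mP : mor N P := mor_comp (fst_hom _ _) (mor_comp k' mM).
pose mQ : mor N Q := mor_comp (snd_hom _ _) (mor_comp k' mM).
pose fP : mor P N := mor_comp fM (mor_comp k (inl P Q)).
pose fQ : mor Q N := mor_comp fM (mor_comp k (inr P Q)).
have fMP x : fM (mM x) = fP (mP x) + fQ (mQ x).
  have fPE y : fP y = fM (k (y, 0)) by [].
  have fQE y : fQ y = fM (k (0, y)) by [].
  rewrite -[in LHS](k'K (mM x)) fPE fQE -!mor_linearD; congr (fM (k _)).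
  rewrite [LHS]surjective_pairing.
  by congr (_, _); rewrite ?addr0 ?add0r.
(* Only the [P]-part of [mM] can be modified, so the contribution of the complement [Q] is moved
   into [a0]. A modification along [a0] is then realized along [a], because [g] can read the
   [Q]-part of its argument. *)
pose a0 : endo N := mor_comp b a + mor_comp fQ mQ.
have [h0 [g0 g0P]] : exists (h0 : mor N P) (g0 : mor P N), forall x,
    g0 (mP x + h0 (a0 x)) = x.
  apply: (modif mP a0 1 fP) => x.
  by rewrite endo1E -[RHS]bfM fMP addrCA.
have [h hE] : exists h : mor N M, forall x, h x = k (h0 (b x), 0).
  by exists (mor_comp k (mor_comp (inl P Q) (mor_comp h0 b))).
have [g gE] : exists g : mor M N, forall y, g y = g0 ((k' y).1 + h0 (fQ (k' y).2)).
  by exists (mor_comp g0 (mor_comp (fst_hom _ _) k' +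
    mor_comp h0 (mor_comp fQ (mor_comp (snd_hom _ _) k')))).
have gm x : g (mM x + h (a x)) = x.
  rewrite gE hE (mor_linearD k') kK /= addr0 -addrA -(mor_linearD h0) -[RHS]g0P.
  by [].
clear - gm thE bfM thK etK.
pose m' x := mM x + h (a x).
(* [y1] and [n1] are the coordinates of [th (0, z)] after the first two automorphisms; [psi] is the
   second coordinate after the third. *)
pose y1 z := (th (0, z)).2 + h (th (0, z)).1.
pose n1 z := (th (0, z)).1 + g (y1 z) - a (g (y1 z)).
have [psi psiE] : exists psi : mor L M, forall z, psi z = y1 z - m' (n1 z).
  pose t := mor_comp th (prod_hom (0 : mor L N) (mor_id L)).
  pose t1 := mor_comp (fst_hom _ _) t; pose t2 := mor_comp (snd_hom _ _) t.
  pose w1 := t2 + mor_comp h t1.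
  pose w2 := t1 + mor_comp g w1 - mor_comp a (mor_comp g w1).
  by exists (w1 - (mor_comp mM w2 + mor_comp h (mor_comp (a : mor _ _) w2))).
have et0 x : et (a x, mM x) = (x, 0) by rewrite -thE thK.
have psi_inj : injective psi.
  suff psi0 z : psi z = 0 -> z = 0.
    move=> z z' zz'; apply/subr0_eq/psi0.
    by rewrite mor_linearB zz' subrr.
  rewrite psiE => /subr0_eq y1E.
  have ny : th (0, z) = (a (n1 z), mM (n1 z)).
    have gy1 : g (y1 z) = n1 z by rewrite y1E gm.
    have e1 : (th (0, z)).1 = a (n1 z).
      have : n1 z = (th (0, z)).1 + n1 z - a (n1 z) by rewrite -{2 3}gy1.
      rewrite addrAC => /(congr1 (fun x => x - n1 z)); rewrite subrr addrK.
      by move=> /esym /subr0_eq.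
    rewrite [LHS]surjective_pairing e1; congr (_, _).
    by move: y1E; rewrite /y1 /m' e1 => /addIr.
  by have := thK (0, z); rewrite ny et0 => -[].
have [chi chiK] : exists chi : M -> L, cancel chi psi.
  (* The inverse automorphisms applied to (0, y), followed by [et]; dropping the [N]-coordinate is
     harmless because [th (x, 0)] is carried into the first factor. *)
  exists (fun y => (et (- (g y - a (g y)), y + h (g y - a (g y)))).2) => y.
  set n := - (g y - a (g y)).
  have -> : y + h (g y - a (g y)) = y - h n by rewrite mor_linearN opprK.
  set x := (et (n, y - h n)).1; set l := (et _).2.
  have : th (x, 0) + th (0, l) = (n, y - h n).
    rewrite -mor_linearD -[RHS]etK; congr (th _); rewrite [RHS]surjective_pairing.
    by congr (_, _); rewrite ?addr0 ?add0r.
  rewrite thE; case E : (th (0, l)) => [n' y'] [nE yE].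
  have n'E : n' = n - a x by rewrite -nE addrC addKr.
  have y'E : y' = y - h n - mM x by rewrite -yE addrC addKr.
  have y1E : y1 l = y - m' x.
    rewrite /y1 E /= n'E y'E /m' mor_linearB opprD -!addrA.
    by congr (_ + _); rewrite addrCA addKr.
  have gy1 : g (y1 l) = g y - x by rewrite y1E mor_linearB gm.
  have n1E : n1 l = - x.
    rewrite /n1 gy1 E /= n'E /n mor_linearB opprB.
    have -> : a (g y) - g y - a x = - g y + (a (g y) - a x) by rewrite addrAC addrC.
    by rewrite addrAC addrK addKr.
  by rewrite psiE y1E n1E /m' !mor_linearN -opprD opprK subrK.
by exists psi; exists chi => // z; apply: psi_inj; rewrite chiK.
Qed.

Lemma direct_summand_prodl (P M A : lmodType T) :
  direct_summand P M -> direct_summand P (A * M)%type.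
Proof.
move=> [C PC]; exists (A * C)%type.
apply: (isomorphic_trans (isomorphic_prodCA P A C)).
by apply: isomorphic_prod; first exact: isomorphic_refl.
Qed.

Lemma cancel_copies (N P : lmodType T) n (L M : lmodType T) :
  (forall (m : mor N P) (a b : endo N) (f : mor P N), (forall x, f (m x) + b (a x) = x) ->
    exists (h : mor N P) (g : mor P N), forall x, g (m x + h (a x)) = x) ->
  direct_summand P M -> isomorphic (copies n N * L)%type (copies n N * M)%type ->
  isomorphic L M.
Proof.
move=> modif PM; elim: n => [|n IH] NLM.
  apply: (isomorphic_trans (isomorphic_sym (isomorphic_copies0 N L))).
  exact: (isomorphic_trans NLM (isomorphic_copies0 N M)).
apply: IH; apply: (cancel_summand modif); first exact: direct_summand_prodl.
have split_off A : isomorphic (N * (copies n N * A))%type (copies n.+1 N * A)%type.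
  apply: (isomorphic_trans (isomorphic_prodA _ _ _)); apply: isomorphic_prod.
    exact/isomorphic_sym/isomorphic_copiesS.
  exact: isomorphic_refl.
apply: (isomorphic_trans (split_off L)); apply: (isomorphic_trans NLM).
exact/isomorphic_sym/split_off.
Qed.

End Isomorphism.

Theorem corollary6p5 (R : comPzRingType) (S : pzRingType)
    (phi : algebra_on R S) (K L M N P : lmodType S^c)
    (R_noetherian : noetherian R)
    (N_fg : finitely_generated N)
    (S_finite : module_finite phi)
    (P_fg : finitely_generated P)
    (P_summand : direct_summand P M)
    (N_summand : let X : set (spec R) := jspec R `&` supp phi N in
       forall p : X, many_copies_summand (dim_at p)
         (loc_mod phi (\val p) N) (loc_mod phi (\val p) P)) :
  (isomorphic (N * L)%type (N * M)%type -> isomorphic L M) /\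
  ((exists n, direct_summand K (copies n N)) ->
   isomorphic (K * L)%type (K * M)%type -> isomorphic L M).
Proof.
set X : set (spec R) := jspec R `&` supp phi N in N_summand.
(* [dim_at] takes points of the subspace, hence the existential over [X]. *)
pose dim_ge (p : spec R) k := exists2 x : X, \val x = p & onat_ge (dim_at x) k.
have dim_ge0 p : X p -> dim_ge p 0.
  move=> Xp; exists (SigSub (mem_set Xp)) => //.
  by case: (dim_at _).
have dim_geS (p q : spec R) k : X p -> X q -> (p : set R) `<=` q -> p <> q ->
    dim_ge q k -> dim_ge p k.+1.
  move=> Xp _ pq npq [y yq yk]; exists (SigSub (mem_set Xp)) => //.
  rewrite -yq in pq npq.
  apply: dim_at_strict yk; first exact/closure_spec.
  by move=> /closure_spec qp; apply: npq; apply: spec_ext; apply/seteqP.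
have X_maximal (q : spec R) : maximal_ideal (q : set R) ->
    X q \/ exists s, ~ (q : set R) s /\ forall x : N, rscale phi s x = 0.
  move=> maxq; have [Nq|nNq] := pselect (supp phi N q); [left|right].
    by split=> //; exact: maximal_jspec.
  exact: annihilator_supp.
have P_splits q k : X q -> dim_ge q k -> splits_at phi N q k.+1 (mor_id P).
  move=> _ [x <- xk]; have := N_summand x; move: xk.
  case: (dim_at x) => [d le_kd|_] /= summand.
    apply: (@splits_at_le _ _ _ _ _ _ (1 + d)) => //.
    exact: direct_summand_splits.
  exact/direct_summand_splits/summand.
have modif (m : mor N P) (a b : endo N) (f : mor P N) (fb : forall x, f (m x) + b (a x) = x) :=
  split_modification R_noetherian S_finite N_fg dim_ge0 dim_geS
    (finite_components_set phi R_noetherian N_fg) X_maximal P_splits P_fg fb.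
split=> [|[n [C KC]] KLM]; first exact: cancel_summand modif P_summand.
apply: (@cancel_copies _ _ _ n L M modif P_summand).
(* Adding the complement [C] of [K] to both sides turns [K] into copies of [N]. *)
have swap (A : lmodType S^c) : isomorphic (copies n N * A)%type (C * (K * A))%type.
  apply: (@isomorphic_trans _ ((K * C) * A)%type).
    by apply: isomorphic_prod; [exact: isomorphic_sym | exact: isomorphic_refl].
  apply: (isomorphic_trans (isomorphic_sym (isomorphic_prodA _ _ _))).
  exact: isomorphic_prodCA.
apply: (isomorphic_trans (swap L)); apply: isomorphic_trans (isomorphic_sym (swap M)).
by apply: isomorphic_prod; first exact: isomorphic_refl.
Qed.
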